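(* There exist positive numerical constants $c_0$, $c_1$, $c_2$ such that the following holds for any $n\ge2$, $p\ge1$, $\delta\in(0,1)$, any $B>0$ and any sequence of independent centered random vectors $y_1,\dots,y_n$ in $\mathbb R^p$ satisfying $\max_t\|y_t\|_{\psi_2}\le B$. With probability higher than $1-\delta$, the change-point estimator $\hat\tau$ described in the context satisfies (NoSp) and detects all change-points $\tau_k$ that have high energy in the sense that $$r_k\|\Sigma_{\tau_k}-\Sigma_{\tau_{k-1}}\|_{op}^2\ge c_1B^4\Big[\Big(p+\log\big(\tfrac{2n}{r_k\delta}\big)\Big)\wedge r_k\Big].$$ Besides, on the same event, any such high-energy change-point $\tau_k$ satisfies $$d_{H,1}(\hat\tau,\tau_k)\le c_2B^4\,\frac{p+\log\big(2\delta^{-1}B^{-4}n\|\Sigma_{\tau_k}-\Sigma_{\tau_{k-1}}\|_{op}^2\big)}{\|\Sigma_{\tau_k}-\Sigma_{\tau_{k-1}}\|_{op}^2}\le\frac{r_k}4 .$$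
   Context: Model. $\Sigma_t$ is the covariance matrix of $y_t$. The change-points $1=\tau_0<\tau_1<\dots<\tau_K<\tau_{K+1}=n+1$ are such that $\Sigma_t$ is constant on each $[\tau_k,\tau_{k+1}-1]$ and $\Sigma_{\tau_k}\ne\Sigma_{\tau_k-1}$; $r_k=\min(\tau_{k+1}-\tau_k,\tau_k-\tau_{k-1})$. $\|\cdot\|_{op}$ is the operator norm. For a real random variable, $\|Z\|_{\psi_2}=\inf\{x>0:\mathbb E[\exp(Z^2/x^2)]\le2\}$; for a random vector, $\|y\|_{\psi_2}=\sup_{\|v\|=1}\|\langle v,y\rangle\|_{\psi_2}$. Dyadic grid $\mathcal G_D$: scales $\mathcal R=\{1,2,4,\dots,2^{\lfloor\log_2 n\rfloor-1}\}$; locations $\mathcal D_1=\{2,\dots,n\}$ and, for $r\in\mathcal R$, $r\ge2$, $\mathcal D_r=\{m\frac r2+1: m\in\mathbb N,\ 2\le m\le\lfloor 2n/r\rfloor-2\}\cup\{n-r+1\}$; $\mathcal G_D=\{(l,r):r\in\mathcal R,l\in\mathcal D_r\}$. Tests. $\widehat\Sigma_{l,-r}=r^{-1}\sum_{t=l-r}^{l-1}y_ty_t^T$, $\widehat\Sigma_{l,r}=r^{-1}\sum_{t=l}^{l+r-1}y_ty_t^T$ and $$T_{l,r}=\mathbf 1\Big\{\|\widehat\Sigma_{l,r}-\widehat\Sigma_{l,-r}\|_{op}\ge c_0B^2\Big[\sqrt{\tfrac pr}+\tfrac pr+\sqrt{\tfrac{\log(2n/(\delta r))}r}+\tfrac{\log(2n/(\delta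 r))}r\Big]\Big\},\quad(l,r)\in\mathcal G_D.$$ Estimator (bottom-up aggregation). For $r\in\mathcal R$ increasing define (closed real intervals) $\mathcal T_r=\{l\in\mathcal D_r:T_{l,r}=1,\ [l-r+1,l+r-1]\cap\bigcup_{r'<r,r'\in\mathcal R}\mathcal S_{r'}=\emptyset\}$ and $\mathcal S_r=\bigcup_{l\in\mathcal T_r}[l-r+1,l+r-1]$. Let $C_1,\dots,C_{\hat K}$ be the connected components of $\bigcup_r\mathcal S_r$ in increasing order, and $\hat\tau_k=\frac12(\min C_k+\max C_k)$. (NoSp): for all $1\le k\le K$ the interval $[\tau_k-\frac{\tau_k-\tau_{k-1}}2,\tau_k+\frac{\tau_{k+1}-\tau_k}2]$ contains at most one $\hat\tau_{k'}$, and all $\hat\tau_{k'}$ lie in $[\tau_1-\frac{\tau_1-1}2,\tau_K+\frac{n+1-\tau_K}2]$; for $K=0$ it means $\hat K=0$. A change-point $\tau_k$ is detected if at least one $\hat\tau_{k'}$ lies in $[\tau_k-\frac{\tau_k-\tau_{k-1}}2,\tau_k+\frac{\tau_{k+1}-\tau_k}2]$. $d_{H,1}(\hat\tau,\tau_k)=\min_{l\le\hat K}|\hat\tau_l-\tau_k|$ ($+\infty$ if $\hat K=0$). *)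

(* Defs.v *)
From HB Require Import structures.
From mathcomp Require Import all_boot all_order all_algebra.
From mathcomp Require Import finmap.
From mathcomp Require Import all_classical all_reals all_analysis.

Set Implicit Arguments.
Unset Strict Implicit.
Unset Printing Implicit Defensive.

Import Order.TTheory GRing.Theory Num.Theory.
Import numFieldNormedType.Exports.

Local Open Scope classical_set_scope.
Local Open Scope ring_scope.

(* Column vectors with the Borel sigma-algebra of the usual topology of R^p. *)
Definition borelV (R : realType) (p : nat) :=
  g_sigma_algebraType (@open 'cV[R]_p).

Section EuclideanSpace.
Context {R : realType} {p : nat}.
Implicit Types (u v : 'cV[R]_p) (A : 'M[R]_p).

Definition dotv u v : R := \sum_(i < p) u i 0 * v i 0.

(* The Euclidean norm; the library norm on matrices is the sup norm. *)
Definition norm2 v : R := Num.sqrt (dotv v v).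

Definition opnorm A : R := sup [set norm2 (A *m v) | v in [set v | norm2 v = 1]].

End EuclideanSpace.

Section RandomVectors.
Context {d : measure_display} {T : measurableType d} {R : realType}.
Variable P : probability T R.

(* The infimum is +oo when no x qualifies. *)
Definition psi2 (Z : T -> R) : \bar R :=
  ereal_inf [set x%:E | x in
    [set x : R | 0 < x /\ ('E_P[fun w => expR (Z w ^+ 2 / x ^+ 2)] <= 2%:E)%E]].

Context {p : nat}.

Definition psi2v (y : T -> borelV R p) : \bar R :=
  ereal_sup [set psi2 (fun w => dotv v (y w)) | v in
    [set v : 'cV[R]_p | norm2 v = 1]].

Definition coordv (y : T -> borelV R p) (i : 'I_p) : T -> R :=
  fun w => (y w : 'cV[R]_p) i 0.

Definition centered (y : T -> borelV R p) : Prop :=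
  forall i, ('E_P[coordv y i] = 0)%E.

Definition cov_matrix (y : T -> borelV R p) : 'M[R]_p :=
  \matrix_(i, j) fine (covariance P (coordv y i) (coordv y j)).

(* Mutual independence of y_1, ..., y_n; product rule over every subfamily. *)
Definition mutually_independent (n : nat) (y : nat -> T -> borelV R p) : Prop :=
  forall s : seq nat, uniq s -> (forall t, t \in s -> (1 <= t <= n)%N) ->
  forall A : nat -> set (borelV R p), (forall t, measurable (A t)) ->
  (P (\bigcap_(t in [set` s]) (y t @^-1` A t)) =
   \prod_(t <- s) P (y t @^-1` A t))%E.

End RandomVectors.

(* tau 1, ..., tau K are the change-points of Sigma 1, ..., Sigma n; the values
   of tau beyond K.+1 are irrelevant. *)
Definition change_points (R : realType) (p n : nat) (Sigma : nat -> 'M[R]_p)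
    (K : nat) (tau : nat -> nat) : Prop :=
  [/\ tau 0%N = 1%N, tau K.+1 = n.+1,
      (forall k, (k <= K)%N -> (tau k < tau k.+1)%N),
      (forall k t, (k <= K)%N -> (tau k <= t < tau k.+1)%N ->
         Sigma t = Sigma (tau k)) &
      (forall k, (1 <= k <= K)%N -> Sigma (tau k) != Sigma (tau k).-1)].

Definition spacing (tau : nat -> nat) (k : nat) : nat :=
  minn (tau k.+1 - tau k) (tau k - tau k.-1).

(* The dyadic grid. The scales are r = 2 ^ j for j < nb_scales n. *)
Definition nb_scales (n : nat) : nat := trunc_log 2 n.

Definition locations (n r : nat) : set nat :=
  if r == 1%N then [set l | (2 <= l <= n)%N]
  else [set (m * (r %/ 2) + 1)%N | m in
          [set m | (2 <= m <= (2 * n) %/ r - 2)%N]] `|` [set (n - r + 1)%N].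

Section Estimator.
Context {R : realType} {p : nat}.
Variables (c0 B delta : R) (n : nat) (x : nat -> 'cV[R]_p).

Definition cov_left (l r : nat) : 'M[R]_p :=
  r%:R^-1 *: \sum_(l - r <= t < l) x t *m (x t)^T.

Definition cov_right (l r : nat) : 'M[R]_p :=
  r%:R^-1 *: \sum_(l <= t < l + r) x t *m (x t)^T.

Definition threshold (r : nat) : R :=
  let L := ln (2 * n%:R / (delta * r%:R)) in
  c0 * B ^+ 2 * (Num.sqrt (p%:R / r%:R) + p%:R / r%:R
                 + Num.sqrt (L / r%:R) + L / r%:R).

Definition test (l r : nat) : bool :=
  threshold r <= opnorm (cov_right l r - cov_left l r).

Definition seg (l r : nat) : set R :=
  `[l%:R - r%:R + 1, l%:R + r%:R - 1]%classic.

(* T_r and S_r at scale r, where U stands for the union of the S_r', r' < r. *)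
Definition kept (r : nat) (U : set R) : set nat :=
  [set l | [/\ locations n r l, test l r & seg l r `&` U = set0]].

Definition layer (r : nat) (U : set R) : set R :=
  \bigcup_(l in kept r U) seg l r.

(* The union of the S_r over the first j scales. *)
Fixpoint covered (j : nat) : set R :=
  if j is i.+1 then covered i `|` layer (2 ^ i)%N (covered i) else set0.

Definition detection_region : set R := covered (nb_scales n).

Definition components : set (set R) :=
  connected_component detection_region @` detection_region.

Lemma seg_connected (l r : nat) : connected (seg l r).
Proof. exact/connected_intervalP/interval_is_interval. Qed.

Lemma finite_locations (r : nat) : finite_set (locations n r).
Proof.
rewrite /locations; case: ifP => _.
  apply: (@sub_finite_set _ _ `I_n.+1); last exact: finite_II.
  by move=> l /= /andP[_ ln]; rewrite ltnS.
rewrite finite_setU; split; last exact: finite_set1.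
apply: finite_image.
apply: (@sub_finite_set _ _ `I_((2 * n) %/ r).+1); last exact: finite_II.
by move=> l /= /andP[_ ln]; rewrite ltnS (leq_trans ln)// leq_subr.
Qed.

Lemma covered_bigcup (j : nat) :
  exists2 L : set (nat * nat), finite_set L &
    covered j = \bigcup_(z in L) seg z.1 z.2.
Proof.
elim: j => [|j [L Lfin Lj]]; first by exists set0; rewrite // bigcup_set0.
exists (L `|` (fun l => (l, 2 ^ j)%N) @` kept (2 ^ j)%N (covered j)).
  rewrite finite_setU; split=> //; apply: finite_image.
  by apply: sub_finite_set (finite_locations (2 ^ j)%N) => l /= [].
by rewrite bigcup_setU -Lj bigcup_image.
Qed.

Lemma finite_components : finite_set components.
Proof.
have [L Lfin LE] := covered_bigcup (nb_scales n).
pose f z := connected_component detection_region (z.1%:R - z.2%:R + 1).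
apply: (@sub_finite_set _ _ (f @` L)); last exact: finite_image.
move=> _ [t + <-]; rewrite {1}/detection_region LE => -[z Lz zt].
exists z => //; rewrite /f; apply: same_connected_component.
exists (seg z.1 z.2) => //; split; last exact: seg_connected.
- by move: zt; rewrite /seg /= !in_itv/= lexx => /andP[]; exact: le_trans.
- by rewrite /detection_region LE => u zu; exists z.
Qed.

(* The vector of the estimated change-points, in increasing order. There are
   finitely many components, so that fset_set enumerates them, and each of them is a
   compact interval, hence its inf and sup are its min and max. *)
Definition tau_hat : seq R :=
  sort <=%R [seq (inf C + sup C) / 2 | C <- fset_set components].

End Estimator.

Section Performance.
Context {R : realType}.
Implicit Types (tau : nat -> nat) (est : seq R).

Definition zone tau (k : nat) : interval R :=
  `[(tau k)%:R - ((tau k)%:R - (tau k.-1)%:R) / 2,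
    (tau k)%:R + ((tau k.+1)%:R - (tau k)%:R) / 2].

Definition no_spurious (n K : nat) tau est : Prop :=
  if K == 0%N then est = [::]
  else (forall k, (1 <= k <= K)%N -> (count [in zone tau k] est <= 1)%N) /\
       (forall t, t \in est ->
          t \in `[(tau 1%N)%:R - ((tau 1%N)%:R - 1) / 2,
                  (tau K)%:R + (n%:R + 1 - (tau K)%:R) / 2]).

Definition detected tau (k : nat) est : Prop :=
  exists2 t, t \in est & t \in zone tau k.

Definition dH1 est (a : R) : \bar R :=
  \big[Order.min/+oo%E]_(t <- est) `|t - a|%:E.

Definition jump {p : nat} (Sigma : nat -> 'M[R]_p) tau (k : nat) : R :=
  opnorm (Sigma (tau k) - Sigma (tau k.-1)).

Definition high_energy (c1 B delta : R) (n p : nat) (Sigma : nat -> 'M[R]_p)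
    tau (k : nat) : Prop :=
  let r : R := (spacing tau k)%:R in
  c1 * B ^+ 4 * Num.min (p%:R + ln (2 * n%:R / (r * delta))) r
    <= r * jump Sigma tau k ^+ 2.

Definition localization_rate (c2 B delta : R) (n p : nat)
    (Sigma : nat -> 'M[R]_p) tau (k : nat) : R :=
  let J := jump Sigma tau k ^+ 2 in
  c2 * B ^+ 4 * ((p%:R + ln (2 * delta^-1 * B ^- 4 * n%:R * J)) / J).

End Performance.

(* Main.v *)
Require Import Defs.
From mathcomp Require Import all_boot all_order all_algebra.
From mathcomp Require Import finmap.
From mathcomp Require Import all_classical all_reals all_analysis.
From mathcomp Require Import measurable_realfun.
From mathcomp Require Import zify ring lra.

Set Implicit Arguments.
Unset Strict Implicit.
Unset Printing Implicit Defensive.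

Import Order.TTheory GRing.Theory Num.Theory.
Import numFieldNormedType.Exports.

Local Open Scope classical_set_scope.
Local Open Scope ring_scope.

(** The proof separates probability from combinatorics.

    Probability. For a unit vector u, the squares <u, y_t>^2 are subexponential, so
    that a Chernoff bound (subexponential_deviation) controls their sums over a window;
    independence enters through the factorization of exponential moments
    (integral_prod_independent). The operator norm of a symmetric matrix is at most
    twice the maximum of its quadratic form over a quarter-net of the sphere
    (opnorm_le_net), and there is such a net with at most 2^(18 p) points
    (exists_net). A union bound over the net and over the windows of the grid, whose
    number at scale r is of order n / r, yields an event of probability larger than
    1 - delta on which every empirical covariance involved in a test is within a
    quarter of the threshold of its mean (deviation_event). The logarithm of
    2 n / (delta r) in the threshold is exactly what pays for the number of windows of
    length r.

    On this event a positive test has a true change-point in its segment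
    (no_false_positive). Hence each connected component of the detection region
    contains a change-point. A component is an interval symmetric about its midpoint
    tau_hat, so it also contains the change-point nearest to tau_hat; as components are
    disjoint, two estimates cannot fall in the same zone (no_spurious_tau_hat).

    For a high-energy change-point, consider the least dyadic scale r at which its energy
    exceeds a large multiple of p + log (2 n / (delta r)). The test at this scale and
    at the nearest location on the left is positive (large_jump_detected), and r is at
    most the localization rate, itself at most a quarter of the spacing
    (scale_selection). Since the change-point is isolated at scale r, aggregation of
    the tests at smaller scales can only produce segments through the same
    change-point, and the component that contains it has its midpoint at distance at
    most r (detection). *)

(** * Expectation of a product of independent factors *)

Section ProductExpectation.
Local Open Scope ereal_scope.
Context {d d' : measure_display} {T : measurableType d} {U : measurableType d'}
  {R : realType}.
Variable mu : {measure set T -> \bar R}.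
Variable Y : T -> U.
Hypothesis mY : measurable_fun setT Y.

Import HBNNSimple.

(* Both sides of eq_integral_weight are limits of the same combinations of
   integrals of indicators, since the approximating simple functions depend on f
   only and not on the weight G. *)
Let weighted_integral_approx (G : T -> R) (f : U -> R)
    (mf : measurable_fun [set: U] (EFin \o f : U -> \bar R)) :
  measurable_fun setT G -> (forall w, 0 <= G w)%R -> (forall u, 0 <= f u)%R ->
  \int[mu]_w (G w * f (Y w))%:E =
  limn (fun n => \sum_(k \in range (nnsfun_approx measurableT mf n))
    (k%:E * \int[mu]_w
       (G w * \1_(nnsfun_approx measurableT mf n @^-1` [set k]) (Y w))%:E)).
Proof.
move=> mG G0 f0.
pose f_ := nnsfun_approx measurableT mf.
transitivity (limn (fun n => \int[mu]_w (G w * f_ n (Y w))%:E)).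
  rewrite -monotone_convergence//.
  - apply: eq_integral => w _; apply/esym/cvg_lim => //.
    under eq_fun do rewrite EFinM.
    rewrite EFinM; apply: cvgeZl => //.
    by apply: cvg_nnsfun_approx => // u _; rewrite lee_fin.
  - move=> n; apply/measurable_EFinP/measurable_funM => //.
    exact: measurableT_comp.
  - by move=> n w _; rewrite lee_fin mulr_ge0.
  - move=> w _ m n mn; rewrite lee_fin ler_wpM2l//.
    exact/lefP/nd_nnsfun_approx.
congr (limn _); apply/funext => n.
have mi k : measurable_fun setT
    (fun w => G w * \1_(f_ n @^-1` [set k]) (Y w))%R.
  apply: measurable_funM => //; apply: measurableT_comp => //.
have -> : \int[mu]_w (G w * f_ n (Y w))%:E =
    \int[mu]_w \sum_(k \in range (f_ n))
      (k%:E * (G w * \1_(f_ n @^-1` [set k]) (Y w))%:E).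
  apply: eq_integral => w _.
  under eq_fsbigr do rewrite -EFinM.
  rewrite fsumEFin//; congr EFin.
  rewrite [in LHS]fimfunE.
  rewrite !fsbig_finite//= big_distrr/=; apply: eq_bigr => k _.
  by rewrite mulrCA.
rewrite ge0_integral_fsum//; last 2 first.
- by move=> k; apply: emeasurable_funM => //; exact/measurable_EFinP.
- move=> k w _; rewrite -EFinM lee_fin mulrCA mulr_ge0//.
  by have := nnfun_muleindic_ge0 (f_ n) k (Y w); rewrite lee_fin.
apply: eq_fsbigr => k /[!inE] -[u _ <-].
rewrite ge0_integralZl//.
- exact/measurable_EFinP.
- by move=> w _; rewrite lee_fin mulr_ge0.
- by rewrite lee_fin.
Qed.

(** The hypothesis says that the measures with densities G1 and G2 have the same
    image under Y. It is the step that replaces, in an expectation of a product,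
    the indicator of an event on one variable by a nonnegative function of it. *)
Lemma eq_integral_weight (G1 G2 : T -> R) :
  measurable_fun setT G1 -> measurable_fun setT G2 ->
  (forall w, 0 <= G1 w)%R -> (forall w, 0 <= G2 w)%R ->
  (forall A, measurable A ->
     \int[mu]_w (G1 w * \1_A (Y w))%:E = \int[mu]_w (G2 w * \1_A (Y w))%:E) ->
  forall f : U -> R, measurable_fun setT f -> (forall u, 0 <= f u)%R ->
  \int[mu]_w (G1 w * f (Y w))%:E = \int[mu]_w (G2 w * f (Y w))%:E.
Proof.
move=> mG1 mG2 G10 G20 G12 f /measurable_EFinP mf f0.
rewrite (weighted_integral_approx mf)// (weighted_integral_approx mf)//.
congr (limn _); apply/funext => n; apply: eq_fsbigr => k _; congr (_ * _).
exact: G12.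
Qed.

End ProductExpectation.

Section IndependentProducts.
Context {d : measure_display} {T : measurableType d} {R : realType} {p n : nat}.
Variables (P : probability T R) (y : nat -> {RV P >-> borelV R p}).
Hypothesis y_indep : mutually_independent P n (fun t => y t).

Let prod_indicE (s : seq nat) (A : nat -> set (borelV R p)) w :
  \prod_(t <- s) (\1_(A t) (y t w) : R) =
  \1_(\bigcap_(t in [set` s]) (y t @^-1` A t)) w.
Proof.
rewrite indicE; have [/set_mem Aw|/negP Aw] := boolP (w \in _).
  rewrite big_seq big1// => t ts; rewrite indicE mem_set//; exact: Aw.
have [t ts At] : exists2 t, t \in s & ~ A t (y t w).
  apply: contrapT => H; apply: Aw; rewrite inE => t /= ts.
  by apply: contrapT => At; apply: H; exists t.
by rewrite (big_rem t)//= indicE memNset// mul0r.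
Qed.

(* Factors indexed by s1 are already general functions, those indexed by s2 are
   still indicators. The induction on s1 moves one index t0 from s2 to s1: the
   induction hypothesis, applied to t0 :: s2, says that the product of the other
   factors has on the events of y t0 the same weight as the constant G2. *)
Let integral_prod_fun_indic (f : nat -> borelV R p -> R) (e : nat -> R)
    (s1 s2 : seq nat) (A : nat -> set (borelV R p)) :
  uniq (s1 ++ s2) -> (forall t, t \in s1 ++ s2 -> (1 <= t <= n)%N) ->
  (forall t, measurable (A t)) ->
  (forall t, measurable_fun setT (f t)) -> (forall t u, 0 <= f t u) ->
  (forall t, t \in s1 -> (\int[P]_w (f t (y t w))%:E = (e t)%:E)%E) ->
  (\int[P]_w (\prod_(t <- s1) f t (y t w) * \prod_(t <- s2) \1_(A t) (y t w))%:E
   = (\prod_(t <- s1) e t)%:E * \prod_(t <- s2) P (y t @^-1` A t))%E.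
Proof.
move=> + + + mf f0; elim: s1 s2 A => [|t0 s1 IH] s2 A us sn mA fe.
  under eq_integral do rewrite big_nil mul1r prod_indicE.
  rewrite big_nil mul1e integral_indic//; last first.
    apply: bigcap_measurableType => t _.
    by rewrite -[X in measurable X]setTI; exact: measurable_funP.
  by rewrite setIT; exact: y_indep us sn _ mA.
have {}us : (t0 \notin s1 ++ s2) && uniq (s1 ++ s2) by [].
have ft0 : (0 <= e t0).
  rewrite -lee_fin -fe ?mem_head//; apply: integral_ge0 => w _.
  by rewrite lee_fin.
have e0 t : t \in s1 -> 0 <= e t.
  move=> ts; rewrite -lee_fin -fe ?inE ?ts ?orbT//.
  by apply: integral_ge0 => w _; rewrite lee_fin.
have pe0 : 0 <= \prod_(t <- s1) e t by rewrite big_seq prodr_ge0.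
pose G1 w : R := \prod_(t <- s1) f t (y t w) * \prod_(t <- s2) \1_(A t) (y t w).
pose c := \prod_(t <- s2) fine (P (y t @^-1` A t)).
have cE : (\prod_(t <- s2) P (y t @^-1` A t))%E = c%:E.
  rewrite /c; elim: (s2) => [|t s IHs]; first by rewrite !big_nil.
  rewrite !big_cons EFinM -IHs fineK//.
  apply: fin_num_measure; rewrite -[X in measurable X]setTI; exact: measurable_funP.
have c0 : 0 <= c.
  by apply: prodr_ge0 => t _; rewrite fine_ge0.
pose G2 (w : T) : R := \prod_(t <- s1) e t * c.
have mprod (g : nat -> borelV R p -> R) s :
    (forall t, measurable_fun setT (g t)) ->
    measurable_fun setT (fun w => \prod_(t <- s) g t (y t w)).
  move=> mg; under eq_fun do rewrite -(mulr1 (\prod_(t <- s) _)).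
  elim: s => [|t s IHs].
    by under eq_fun do rewrite big_nil; exact: measurable_cst.
  under eq_fun do rewrite big_cons mulr1.
  apply: measurable_funM; first exact: measurableT_comp.
  by move: IHs; under eq_fun do rewrite mulr1.
have mG1 : measurable_fun setT G1.
  apply: measurable_funM; first exact: mprod.
  exact: (mprod (fun t => \1_(A t))).
have mG2 : measurable_fun setT G2 by exact: measurable_cst.
have G1A B : measurable B -> (\int[P]_w (G1 w * \1_B (y t0 w))%:E =
    \int[P]_w (G2 w * \1_B (y t0 w))%:E)%E.
  move=> mB; pose A' t := if t == t0 then B else A t.
  have A'E s g : t0 \notin s -> \prod_(t <- s) (g t (A' t) : R) =
      \prod_(t <- s) g t (A t).
    move=> t0s; apply: eq_big_seq => t ts; rewrite /A'; case: eqP => // tt0.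
    by rewrite -tt0 ts in t0s.
  move: (us) => /andP[]; rewrite mem_cat negb_or => /andP[t0s1 t0s2] us12.
  transitivity (\int[P]_w (\prod_(t <- s1) f t (y t w) *
      \prod_(t <- t0 :: s2) \1_(A' t) (y t w))%:E)%E.
    apply: eq_integral => w _; congr EFin.
    rewrite big_cons /G1 (A'E s2 (fun t A => \1_A (y t w)))// /A' eqxx.
    by rewrite -mulrA [X in _ * X]mulrC.
  rewrite (IH (t0 :: s2) A').
  - rewrite big_cons {1}/A' eqxx.
    rewrite (_ : (\prod_(t <- s2) _)%E = c%:E); last first.
      rewrite -cE; apply: eq_big_seq => t ts; rewrite /A'; case: eqP => // tt0.
      by rewrite -tt0 ts in t0s2.
    under [RHS]eq_integral do rewrite /G2 EFinM.
    rewrite ge0_integralZl//; last 2 first.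
    + by apply/measurable_EFinP; apply: measurableT_comp.
    + by rewrite lee_fin mulr_ge0.
    rewrite (_ : (fun w => (\1_B (y t0 w))%:E) =
      (fun w => (\1_(y t0 @^-1` B) w)%:E))//.
    rewrite integral_indic//; last first.
      by rewrite -[X in measurable X]setTI; exact: measurable_funP.
    by rewrite setIT /G2 EFinM -muleA; congr (_ * _)%E; exact: muleC.
  - by rewrite -cat1s uniq_catCA.
  - move=> t; rewrite mem_cat inE => tt; apply: sn.
    by rewrite inE mem_cat; case/orP: tt => [->|/orP[->|->]]; rewrite ?orbT.
  - by move=> t; rewrite /A'; case: ifP.
  - by move=> t ts; apply: fe; rewrite inE ts orbT.
transitivity (\int[P]_w (G1 w * f t0 (y t0 w))%:E)%E.
  by apply: eq_integral => w _; rewrite big_cons /G1; congr EFin; ring.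
rewrite (@eq_integral_weight _ _ _ _ _ P (y t0) _ G1 G2)//; last 2 first.
- by move=> w; rewrite /G1 mulr_ge0// prodr_ge0.
- by move=> w; rewrite /G2 mulr_ge0.
under eq_integral do rewrite /G2 EFinM.
rewrite ge0_integralZl//; last 3 first.
- by apply/measurable_EFinP; apply: measurableT_comp.
- by move=> w _; rewrite lee_fin.
- by rewrite lee_fin mulr_ge0.
rewrite fe ?mem_head// big_cons cE -!EFinM; congr EFin; rewrite /G2; ring.
Qed.

(** Independence, stated on events, gives the factorization of the exponential
    moments of a sum. *)
Lemma integral_prod_independent (f : nat -> borelV R p -> R) (e : nat -> R)
    (s : seq nat) :
  uniq s -> (forall t, t \in s -> (1 <= t <= n)%N) ->
  (forall t, measurable_fun setT (f t)) -> (forall t u, 0 <= f t u) ->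
  (forall t, t \in s -> (\int[P]_w (f t (y t w))%:E = (e t)%:E)%E) ->
  (\int[P]_w (\prod_(t <- s) f t (y t w))%:E = (\prod_(t <- s) e t)%:E)%E.
Proof.
move=> us sn mf f0 fe.
have := @integral_prod_fun_indic f e s [::] (fun=> set0).
rewrite !cats0 => /(_ us sn (fun=> measurable0) mf f0 fe).
under eq_integral do rewrite big_nil mulr1.
by rewrite big_nil mule1.
Qed.

End IndependentProducts.

(** * Moment generating function of a subexponential variable *)

Section ExponentialMoments.
Context {R : realType}.
Implicit Types s x theta : R.

(** Both signs of x follow from the single inequality
    e^x - 1 <= x e^x, which is 1 - x <= e^-x multiplied by e^x. *)
Lemma expR_le_quadratic x : expR x <= 1 + x + x ^+ 2 * expR `|x|.
Proof.
have h : expR x - 1 <= x * expR x.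
  have := ler_wpM2l (ltW (expR_gt0 x)) (expR_ge1Dx (- x)).
  rewrite -expRD subrr expR0; lra.
have h1 := expR_ge1Dx x; have [x0|x0] := leP 0 x.
  have := ler_wpM2l x0 h; rewrite ger0_norm// => h2.
  by move: h h2; rewrite expr2; set e := expR x => h h2; nra.
have e1 : 1 <= expR `|x| by rewrite -expR0 ler_expR.
have : x ^+ 2 * 1 <= x ^+ 2 * expR `|x| by rewrite ler_wpM2l ?sqr_ge0.
have : 0 <= - x by lra.
by move: h h1; set e := expR x => h h1 x0' h2; rewrite expr2 in h2 *; nra.
Qed.

(** The quadratic remainder (theta s)^2 e^(s/2) is absorbed by e^s because
    s^2 <= 16 e^(s/2), hence a bound that can be integrated when only E e^S is
    controlled. *)
Lemma expR_tilt_le theta s : 0 <= s -> `|theta| <= 2^-1 ->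
  expR (theta * s) <= 1 + theta * s + 16 * theta ^+ 2 * expR s.
Proof.
move=> s0 th; apply: le_trans (expR_le_quadratic _) _; rewrite lerD2l.
suff H : s ^+ 2 * expR (`|theta| * s) <= expR s * 16.
  have := ler_wpM2l (sqr_ge0 theta) H; rewrite normrM (ger0_norm s0) exprMn; lra.
have e4 : (s / 4) ^+ 2 <= expR (s / 4) ^+ 2.
  have h := expR_ge1Dx (s / 4).
  by apply: lerXn2r; rewrite ?nnegrE ?expR_ge0//; lra.
have -> : expR s = expR (s / 4) ^+ 2 * expR (2^-1 * s).
  by rewrite expr2 -!expRD; congr expR; field.
have et : expR (`|theta| * s) <= expR (2^-1 * s) by rewrite ler_expR ler_wpM2r.
rewrite [leRHS]mulrAC ler_pM ?sqr_ge0 ?expR_ge0//.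
by move: e4; rewrite !expr2; lra.
Qed.

End ExponentialMoments.

Section ExponentialMomentsRV.
Context {d : measure_display} {T : measurableType d} {R : realType}.
Variable P : probability T R.

Section one_variable.
Variable S : T -> R.
Hypotheses (mS : measurable_fun setT S) (S0 : forall w, 0 <= S w)
  (ES : (\int[P]_w (expR (S w))%:E <= 2%:E)%E).

Let mean := fine (\int[P]_w (S w)%:E).

Lemma integrable_expR : P.-integrable setT (fun w => (expR (S w))%:E).
Proof.
apply/integrableP; split; first by apply/measurable_EFinP/measurableT_comp.
under eq_integral do rewrite gee0_abs ?lee_fin ?expR_ge0//.
exact: le_lt_trans ES (ltry _).
Qed.

Lemma integrable_sub_expR : P.-integrable setT (fun w => (S w)%:E).
Proof.
apply: le_integrable integrable_expR => //; first exact/measurable_EFinP.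
move=> w _; rewrite !abse_EFin lee_fin !ger0_norm ?expR_ge0//.
have := expR_ge1Dx (S w); lra.
Qed.

Lemma mean_le1 : 0 <= mean <= 1.
Proof.
rewrite fine_ge0 ?integral_ge0//=; last by move=> w _; rewrite lee_fin.
rewrite -lee_fin fineK ?(integrable_fin_num _ integrable_sub_expR)//.
have : (\int[P]_w (1 + (S w)%:E) <= 2%:E)%E.
  apply: le_trans ES; apply: ge0_le_integral => //.
  - by move=> w _; rewrite -EFinD lee_fin addr_ge0.
  - by apply: emeasurable_funD => //; exact/measurable_EFinP.
  - by apply/measurable_EFinP/measurableT_comp.
  - by move=> w _; rewrite -EFinD lee_fin expR_ge1Dx.
rewrite ge0_integralD//; last 2 first.
- by move=> w _; rewrite lee_fin.
- exact/measurable_EFinP.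
rewrite integral_cst//= probability_setT mule1.
rewrite -(fineK (integrable_fin_num _ integrable_sub_expR))// -EFinD !lee_fin.
lra.
Qed.

(** Integrating expR_tilt_le gives E e^(theta S) <= 1 + theta E S + 32 theta^2,
    and 1 + z <= e^z turns this into the bound for the centered variable. *)
Lemma centered_mgf_le theta : `|theta| <= 2^-1 ->
  (\int[P]_w (expR (theta * (S w - mean)))%:E <= (expR (32 * theta ^+ 2))%:E)%E.
Proof.
move=> th.
have Sfin := integrable_fin_num measurableT integrable_sub_expR.
have Efin := integrable_fin_num measurableT integrable_expR.
have meanE : (\int[P]_w (S w)%:E)%E = mean%:E by rewrite fineK.
pose m2 := fine (\int[P]_w (expR (S w))%:E)%E.
have m2E : (\int[P]_w (expR (S w))%:E)%E = m2%:E by rewrite fineK.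
have m2le : m2 <= 2 by rewrite -lee_fin -m2E.
have i1 : P.-integrable setT (EFin \o (fun w => 1 + theta * S w)).
  rewrite (_ : _ \o _ = (fun w => 1%:E + theta%:E * (S w)%:E)%E)//.
  apply: integrableD => //; first exact: finite_measure_integrable_cst.
  exact: integrableZl integrable_sub_expR.
have i2 : P.-integrable setT (EFin \o (fun w => 16 * theta ^+ 2 * expR (S w))).
  rewrite (_ : _ \o _ =
    (fun w => (16 * theta ^+ 2)%:E * (expR (S w))%:E)%E)//.
  exact: integrableZl integrable_expR.
have H : (\int[P]_w (expR (theta * S w))%:E <=
    (1 + theta * mean + 32 * theta ^+ 2)%:E)%E.
  apply: (@le_trans _ _ (\int[P]_w ((1 + theta * S w) +
      16 * theta ^+ 2 * expR (S w))%:E)%E).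
    apply: ge0_le_integral => //.
    - apply/measurable_EFinP; apply: measurableT_comp => //.
      exact: measurable_funM.
    - exact: (measurable_int P (integrableD measurableT i1 i2)).
    - by move=> w _; rewrite lee_fin expR_tilt_le.
  under eq_integral do rewrite EFinD.
  rewrite (integralD_EFin measurableT i1 i2) /=.
  have -> : (\int[P]_w (1 + theta * S w)%:E = (1 + theta * mean)%:E)%E.
    under eq_integral do rewrite EFinD EFinM.
    rewrite integralD//; last 2 first.
    - exact: finite_measure_integrable_cst.
    - exact: integrableZl integrable_sub_expR.
    rewrite integralZl//; last exact: integrable_sub_expR.
    by rewrite integral_cst//= probability_setT mule1 meanE -EFinM -EFinD.
  have -> : (\int[P]_w (16 * theta ^+ 2 * expR (S w))%:E =
      (16 * theta ^+ 2 * m2)%:E)%E.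
    under eq_integral do rewrite EFinM.
    by rewrite integralZl//; [rewrite m2E|exact: integrable_expR].
  rewrite -EFinD lee_fin.
  have := sqr_ge0 theta; nra.
under eq_integral do rewrite mulrBr expRD EFinM muleC.
rewrite ge0_integralZl//; last first.
  apply/measurable_EFinP; apply: measurableT_comp => //.
  exact: measurable_funM.
apply: (@le_trans _ _ ((expR (- (theta * mean)))%:E *
    (expR (theta * mean + 32 * theta ^+ 2))%:E)%E); last first.
  by rewrite -EFinM -expRD lee_fin addKr.
rewrite lee_wpmul2l ?lee_fin ?expR_ge0//; apply: le_trans H _.
by rewrite lee_fin -addrA expR_ge1Dx.
Qed.

End one_variable.

Lemma exponential_markov (X : T -> R) (x : R) : measurable_fun setT X ->
  (P [set w | (x <= X w)%R] <= (expR (- x))%:E * \int[P]_w (expR (X w))%:E)%E.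
Proof.
move=> mX; have mA : measurable [set w | (x <= X w)%R].
  have -> : [set w | (x <= X w)%R] = X @^-1` `[x, +oo[.
    by apply/seteqP; split => w /=; rewrite in_itv/= andbT.
  by rewrite -[X in measurable X]setTI; exact: mX.
rewrite -ge0_integralZl//; last by apply/measurable_EFinP/measurableT_comp.
rewrite -[X in (P X <= _)%E]setIT -integral_indic//.
apply: ge0_le_integral => //.
- exact/measurable_EFinP/measurable_indic.
- apply: emeasurable_funM => //.
  by apply/measurable_EFinP/measurableT_comp.
move=> w _; rewrite -EFinM lee_fin -expRD indicE; case: (boolP (w \in _)).
  by rewrite inE/= => xX; rewrite -expR0 ler_expR; lra.
by move=> _; exact: expR_ge0.
Qed.

End ExponentialMomentsRV.

(** * Operator norm and quadratic forms *)

Section EuclideanGeometry.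
Context {R : realType} {p : nat}.
Implicit Types (u v w : 'cV[R]_p) (A B : 'M[R]_p).

Lemma dotvC u v : dotv u v = dotv v u.
Proof. by apply: eq_bigr => i _; rewrite mulrC. Qed.

Lemma dotvDr u v w : dotv u (v + w) = dotv u v + dotv u w.
Proof. by rewrite /dotv -big_split; apply: eq_bigr => i _; rewrite mxE mulrDr. Qed.

Lemma dotvZr a u v : dotv u (a *: v) = a * dotv u v.
Proof. by rewrite /dotv mulr_sumr; apply: eq_bigr => i _; rewrite mxE mulrCA. Qed.

Lemma dotvDl u v w : dotv (u + v) w = dotv u w + dotv v w.
Proof. by rewrite dotvC dotvDr !(dotvC w). Qed.

Lemma dotvZl a u v : dotv (a *: u) v = a * dotv u v.
Proof. by rewrite dotvC dotvZr dotvC. Qed.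

Lemma dotvNr u v : dotv u (- v) = - dotv u v.
Proof. by rewrite -scaleN1r dotvZr mulN1r. Qed.

Lemma dotvNl u v : dotv (- u) v = - dotv u v.
Proof. by rewrite dotvC dotvNr dotvC. Qed.

Lemma dotv_ge0 v : 0 <= dotv v v.
Proof. by apply: sumr_ge0 => i _; rewrite -expr2 sqr_ge0. Qed.

Lemma norm2_ge0 v : 0 <= norm2 v.
Proof. exact: sqrtr_ge0. Qed.

#[local] Hint Resolve norm2_ge0 : core.

Lemma sqr_norm2 v : norm2 v ^+ 2 = dotv v v.
Proof. by rewrite sqr_sqrtr ?dotv_ge0. Qed.

Lemma norm2_eq0 v : norm2 v = 0 -> v = 0.
Proof.
move=> v0; have : dotv v v == 0 by rewrite -sqr_norm2 v0 expr0n.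
rewrite psumr_eq0 => [/allP vi|i _]; last by rewrite -expr2 sqr_ge0.
apply/matrixP => i j; rewrite ord1 mxE; apply/eqP.
by have := vi i (mem_index_enum _); rewrite /= mulf_eq0 orbb.
Qed.

Lemma dotv0l v : dotv 0 v = 0.
Proof. by rewrite -(scale0r (0 : 'cV[R]_p)) dotvZl mul0r. Qed.

Lemma norm2_0 : norm2 (0 : 'cV[R]_p) = 0.
Proof. by rewrite /norm2 dotv0l sqrtr0. Qed.

Lemma norm2Z a v : norm2 (a *: v) = `|a| * norm2 v.
Proof. by rewrite /norm2 dotvZl dotvZr mulrA -expr2 sqrtrM ?sqr_ge0// sqrtr_sqr. Qed.

(** Expansion of | |v| w - |w| v |^2 >= 0. *)
Lemma cauchy_schwarz u v : `|dotv u v| <= norm2 u * norm2 v.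
Proof.
suff H w : dotv w v <= norm2 w * norm2 v.
  rewrite ler_norml H andbT lerNl -dotvNl; apply: le_trans (H _) _.
  by rewrite -scaleN1r norm2Z normrN normr1 mul1r.
have [w0|wn0] := eqVneq (norm2 w) 0.
  by rewrite w0 mul0r (norm2_eq0 w0) dotv0l.
have [v0|vn0] := eqVneq (norm2 v) 0.
  by rewrite v0 mulr0 (norm2_eq0 v0) dotvC dotv0l.
have w0 : 0 < norm2 w by rewrite lt_def wn0 norm2_ge0.
have v0 : 0 < norm2 v by rewrite lt_def vn0 norm2_ge0.
have := dotv_ge0 (norm2 v *: w - norm2 w *: v).
rewrite !(dotvDl, dotvDr, dotvNl, dotvNr, dotvZl, dotvZr) -!sqr_norm2 (dotvC v w).
have : 0 < norm2 w * norm2 v by exact: mulr_gt0.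
set a := norm2 w; set b := norm2 v; set c := dotv w v => ab h.
by rewrite -(ler_pM2l ab); nra.
Qed.

Lemma ler_norm2D u v : norm2 (u + v) <= norm2 u + norm2 v.
Proof.
rewrite -(@ler_pXn2r _ 2) ?nnegrE ?addr_ge0 ?norm2_ge0//.
rewrite sqr_norm2 !(dotvDl, dotvDr) sqrrD !sqr_norm2 (dotvC v u).
have := le_trans (ler_norm _) (cauchy_schwarz u v); lra.
Qed.

Let unit_images A := [set norm2 (A *m v) | v in [set v | norm2 v = 1]].

Let has_ubound_unit_images A : has_ubound (unit_images A).
Proof.
exists (Num.sqrt (\sum_i norm2 (row i A)^T ^+ 2)) => _ [v v1 <-].
rewrite ler_sqrt; last by apply: sumr_ge0 => i _; exact: sqr_ge0.
apply: ler_sum => i _.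
have -> : (A *m v) i 0 = dotv (row i A)^T v.
  by rewrite mxE; apply: eq_bigr => j _; rewrite !mxE.
have := cauchy_schwarz (row i A)^T v; rewrite v1 mulr1 => h.
by rewrite -expr2 -real_normK ?num_real// lerXn2r ?nnegrE ?norm2_ge0.
Qed.

Lemma norm2_mulmx_le A v : norm2 (A *m v) <= opnorm A * norm2 v.
Proof.
have [v0|vn0] := eqVneq (norm2 v) 0.
  by rewrite (norm2_eq0 v0) mulmx0 norm2_0 mulr0.
have v0 : 0 < norm2 v by rewrite lt_def vn0 norm2_ge0.
rewrite -ler_pdivrMr// mulrC -[(norm2 v)^-1]ger0_norm ?invr_ge0 ?norm2_ge0//.
rewrite -norm2Z scalemxAr; apply: sup_upper_bound.
  split; last exact: has_ubound_unit_images.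
  by exists (norm2 (A *m ((norm2 v)^-1 *: v))); exists ((norm2 v)^-1 *: v);
    rewrite //= norm2Z ger0_norm ?invr_ge0 ?norm2_ge0// mulVf.
exists ((norm2 v)^-1 *: v) => //=.
by rewrite norm2Z ger0_norm ?invr_ge0 ?norm2_ge0// mulVf.
Qed.

Lemma opnorm_le A c : 0 <= c ->
  (forall v, norm2 v = 1 -> norm2 (A *m v) <= c) -> opnorm A <= c.
Proof.
move=> c0 Ac; rewrite /opnorm.
have [->|/set0P ne] := eqVneq ([set norm2 (A *m v) | v in [set v | norm2 v = 1]]) set0.
  by rewrite sup0.
by apply: sup_le_ub => // _ [v v1 <-]; exact: Ac.
Qed.

Lemma opnorm_ge0 A : 0 <= opnorm A.
Proof.
rewrite /opnorm.
have [->|/set0P[x Ax]] :=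
  eqVneq ([set norm2 (A *m v) | v in [set v | norm2 v = 1]]) set0.
  by rewrite sup0.
apply: (@le_trans _ _ x); first by case: Ax => v _ <-; exact: norm2_ge0.
by apply: sup_upper_bound => //; split; [exists x|exact: has_ubound_unit_images].
Qed.

Lemma ler_opnormD A B : opnorm (A + B) <= opnorm A + opnorm B.
Proof.
apply: opnorm_le; first by rewrite addr_ge0 ?opnorm_ge0.
move=> v v1; rewrite mulmxDl; apply: le_trans (ler_norm2D _ _) _.
by apply: lerD; rewrite -[leRHS]mulr1 -v1 norm2_mulmx_le.
Qed.

Lemma opnormN A : opnorm (- A) = opnorm A.
Proof.
rewrite /opnorm; congr sup; apply: eq_imagel => v _.
by rewrite mulNmx -scaleN1r norm2Z normrN normr1 mul1r.
Qed.

Lemma opnormZ_le a A : opnorm (a *: A) <= `|a| * opnorm A.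
Proof.
apply: opnorm_le; first by rewrite mulr_ge0 ?opnorm_ge0.
move=> v v1; rewrite -scalemxAl norm2Z ler_wpM2l//.
by rewrite -[leRHS]mulr1 -v1 norm2_mulmx_le.
Qed.

Lemma opnormZ a A : opnorm (a *: A) = `|a| * opnorm A.
Proof.
have [->|a0] := eqVneq a 0.
  apply/eqP; rewrite eq_le opnormZ_le normr0 mul0r; exact: opnorm_ge0.
apply/eqP; rewrite eq_le opnormZ_le/= -ler_pdivlMl ?normr_gt0//.
by rewrite -normfV -[A in leLHS](scalerK a0) opnormZ_le.
Qed.

Lemma dotvE u v : dotv u v = (u^T *m v) 0 0.
Proof. by rewrite mxE; apply: eq_bigr => i _; rewrite mxE. Qed.

Lemma dotv_mulmx_sym A u v : A^T = A -> dotv u (A *m v) = dotv v (A *m u).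
Proof.
move=> symA; rewrite !dotvE.
have -> : v^T *m (A *m u) = (u^T *m (A *m v))^T.
  by rewrite !trmx_mul symA trmxK mulmxA.
by rewrite [RHS]mxE.
Qed.

Definition quad A v := dotv v (A *m v).

Lemma quadB A B u : quad (A - B) u = quad A u - quad B u.
Proof. by rewrite /quad mulmxBl dotvDr dotvNr. Qed.

Lemma quadZ a A u : quad (a *: A) u = a * quad A u.
Proof. by rewrite /quad -scalemxAl dotvZr. Qed.

(** The points of the net lie in the unit ball and not on the sphere, so that a
    lattice can be used. *)
Definition is_net (eps : R) (N : seq 'cV[R]_p) :=
  (forall u, u \in N -> norm2 u <= 1) /\
  (forall v, norm2 v = 1 -> exists2 u, u \in N & norm2 (v - u) <= eps).

(** Polarization: for unit u and v, 4 <u, A v> is the difference of the quadratic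
    forms at u + v and u - v, hence at most q (|u + v|^2 + |u - v|^2) = 4 q; take
    u in the direction of A v. This avoids the spectral theorem. *)
Lemma opnorm_le_quad A q : A^T = A -> 0 <= q ->
  (forall v, norm2 v = 1 -> `|quad A v| <= q) -> opnorm A <= q.
Proof.
move=> symA q0 A_unit.
have Aq v : `|quad A v| <= q * norm2 v ^+ 2.
  have [v0|vn0] := eqVneq (norm2 v) 0.
    by rewrite v0 /quad (norm2_eq0 v0) dotv0l normr0 expr0n mulr0.
  have := A_unit ((norm2 v)^-1 *: v).
  rewrite norm2Z ger0_norm ?invr_ge0 ?norm2_ge0// mulVf// => /(_ erefl).
  rewrite /quad -scalemxAr dotvZl dotvZr mulrA -expr2 normrM exprVn normfV.
  rewrite (ger0_norm (sqr_ge0 _)) mulrC ler_pdivrMr//.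
  by rewrite exprn_gt0// lt_def vn0 norm2_ge0.
apply: opnorm_le => // v v1.
have dotA x z := dotv_mulmx_sym x z symA.
have [Av0|Avn0] := eqVneq (norm2 (A *m v)) 0; first by rewrite Av0.
set a := norm2 (A *m v) in Avn0 *.
have a0 : 0 < a by rewrite lt_def Avn0 norm2_ge0.
pose u := a^-1 *: (A *m v).
have u1 : norm2 u = 1 by rewrite norm2Z ger0_norm ?invr_ge0 ?ltW// mulVf.
have -> : a = dotv u (A *m v).
  by rewrite dotvZl -sqr_norm2 -/a expr2 mulKf.
have pol : 4 * dotv u (A *m v) = quad A (u + v) - quad A (u - v).
  rewrite /quad !mulmxDr !mulmxN !(dotvDl, dotvDr, dotvNl, dotvNr) (dotA v u); ring.
have := le_trans (ler_norm _) (Aq (u + v)).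
have := Aq (u - v); rewrite ler_norml => /andP[h _].
move: h; rewrite !sqr_norm2 !(dotvDl, dotvDr, dotvNl, dotvNr) -!sqr_norm2 u1 v1.
rewrite (dotvC v u); lra.
Qed.

(** For u in the net close to v, the quadratic forms at v and u differ by
    <v - u, A (v + u)>, which is at most half the operator norm; the latter is
    then absorbed in the left-hand side. *)
Lemma opnorm_le_net A N eta : A^T = A -> 0 <= eta -> is_net 4^-1 N ->
  (forall u, u \in N -> `|quad A u| <= eta) -> opnorm A <= 2 * eta.
Proof.
move=> symA eta0 [N1 Nnet] AN.
have dotA x z := dotv_mulmx_sym x z symA.
have H v : norm2 v = 1 -> `|quad A v| <= eta + 2^-1 * opnorm A.
  move=> v1; have [u uN vu] := Nnet v v1.
  have -> : quad A v = quad A u + dotv (v - u) (A *m (v + u)).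
    rewrite /quad !mulmxDr !(dotvDl, dotvDr, dotvNl) (dotA u v); ring.
  apply: le_trans (ler_normD _ _) _; apply: lerD; first exact: AN.
  apply: le_trans (cauchy_schwarz _ _) _.
  have h1 := norm2_mulmx_le A (v + u).
  have h2 := ler_norm2D v u; have h3 := N1 u uN; have h4 := opnorm_ge0 A.
  have h5 : norm2 (A *m (v + u)) <= opnorm A * 2.
    by apply: le_trans h1 _; rewrite ler_wpM2l// (le_trans h2)// v1; lra.
  apply: le_trans (ler_pM (norm2_ge0 _) (norm2_ge0 _) vu h5) _; lra.
suff : opnorm A <= eta + 2^-1 * opnorm A by lra.
have A0 := opnorm_ge0 A; apply: opnorm_le_quad => //; lra.
Qed.

End EuclideanGeometry.

(** * A quarter-net of the unit sphere of exponential size *)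

Section LatticeNet.
Context {R : realType} {p : nat}.
Hypothesis p_gt0 : (0 < p)%N.

(* The net is the trace on the unit ball of the lattice of mesh 1 / (4 sqrt p). A
   lattice point is encoded by the signs and the absolute values of its integer
   coordinates; rounding each coordinate of a unit vector towards zero stays in
   the unit ball and moves the vector by at most 1 / 4. *)
Let step : R := (4 * Num.sqrt p%:R)^-1.

Let cell := (bool * 'I_(4 * p).+1)%type.

Let lattice_point (f : {ffun 'I_p -> cell}) : 'cV[R]_p :=
  \col_i ((-1) ^+ (f i).1 * (f i).2%:R * step).

Let lattice_seq := [seq lattice_point f | f : {ffun 'I_p -> cell} in
  [pred f : {ffun 'I_p -> cell} | (\sum_i (f i).2 <= 16 * p)%N & norm2 (lattice_point f) <= 1]].

Let sum_weights : \sum_(c : cell) (2^-1 : R) ^+ c.2 <= 4.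
Proof.
rewrite -(pair_bigA _ (fun (b : bool) (k : 'I_(4 * p).+1) => (2^-1 : R) ^+ k))/=.
rewrite big_bool/=.
suff H m : \sum_(k < m) (2^-1 : R) ^+ k <= 2.
  by have := H (4 * p).+1; lra.
suff -> : \sum_(k < m) (2^-1 : R) ^+ k = 2 - 2 * 2^-1 ^+ m.
  by rewrite gerBl mulr_ge0// exprn_ge0.
elim: m => [|m IH]; first by rewrite big_ord0 expr0; ring.
by rewrite big_ord_recr/= IH exprS; field.
Qed.

(* As sum k_i <= 16 p, the weight 2^(16 p) prod 2^(- k_i) is at least 1. The sum of
   the weights over all the lattice factorizes over the coordinates, and each factor
   is at most 4. *)
Let size_lattice_seq : (size lattice_seq)%:R <= (2 ^+ 18) ^+ p :> R.
Proof.
rewrite size_map -cardE -sum1_card natr_sum.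
pose weight (f : {ffun 'I_p -> cell}) : R := \prod_i 2^-1 ^+ (f i).2.
apply: (@le_trans _ _ (\sum_f 2 ^+ (16 * p) * weight f)).
  rewrite [leRHS](bigID (fun f => f \in [pred f : {ffun 'I_p -> cell} |
    (\sum_i (f i).2 <= 16 * p)%N & norm2 (lattice_point f) <= 1]))/=.
  rewrite -[leLHS]addr0 lerD//; last first.
    apply: sumr_ge0 => f _; rewrite mulr_ge0 ?exprn_ge0//.
    by apply: prodr_ge0 => i _; rewrite exprn_ge0.
  apply: ler_sum => f /andP[fle _].
  rewrite /weight -expr_sum exprVn -expfB_cond; last by rewrite pnatr_eq0.
  by rewrite exprn_ege1// ler1n.
rewrite -mulr_sumr -(bigA_distr_bigA (fun (_ : 'I_p) (c : cell) => 2^-1 ^+ c.2 : R))/=.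
rewrite prodr_const card_ord.
have : (\sum_(c : cell) (2^-1 : R) ^+ c.2) ^+ p <= 4 ^+ p.
  by apply: lerXn2r => //; rewrite nnegrE//; apply: sumr_ge0 => c _; rewrite exprn_ge0.
move=> h; apply: le_trans (ler_wpM2l _ h) _; first exact: exprn_ge0.
rewrite exprM -exprMn; apply: lerXn2r; rewrite ?nnegrE// ; lra.
Qed.

(** The restriction sum k_i <= 16 p excludes no point of the unit ball, since
    sum k_i <= sum k_i^2 = (4 sqrt p)^2 |v|^2; so the elementary count of
    lattice_seq replaces the usual volumetric bound. *)
Lemma exists_net : exists2 N : seq 'cV[R]_p, is_net 4^-1 N &
  (size N)%:R <= (2 ^+ 18) ^+ p :> R.
Proof.
exists lattice_seq => //; split.
  by move=> _ /mapP[f + ->]; rewrite mem_enum => /andP[].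
move=> v v1.
have p0 : 0 < p%:R :> R by rewrite ltr0n.
have sp0 : 0 < Num.sqrt p%:R :> R by rewrite sqrtr_gt0.
have step0 : 0 < step by rewrite invr_gt0 mulr_gt0.
have stepE : p%:R * step ^+ 2 = 16^-1.
  rewrite /step exprVn exprMn sqr_sqrtr ?ltW//; field; lra.
have vle1 i : `|v i 0| <= 1.
  rewrite -(@ler_pXn2r _ 2)// ?nnegrE// expr1n real_normK ?num_real//.
  have <- : dotv v v = 1 by rewrite -sqr_norm2 v1 expr1n.
  rewrite /dotv (bigD1 i)//= -expr2 lerDl sumr_ge0// => j _.
  by rewrite -expr2 sqr_ge0.
pose k i := Num.truncn (`|v i 0| / step).
have kP i : (k i)%:R <= `|v i 0| / step < (k i).+1%:R.
  by apply: truncn_itv; rewrite divr_ge0// ltW.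
have klt i : (k i < (4 * p).+1)%N.
  rewrite ltnS -(ler_nat R); have /andP[h _] := kP i; apply: le_trans h _.
  rewrite ler_pdivrMr// (le_trans (vle1 i))// /step natrM.
  rewrite ler_pdivlMr ?mulr_gt0// mul1r ler_wpM2l//.
  have pE : Num.sqrt p%:R * Num.sqrt p%:R = p%:R :> R.
    by rewrite -expr2 sqr_sqrtr// ltW.
  rewrite -{2}pE ler_peMl ?(ltW sp0)//.
  by rewrite -[leLHS]sqrtr1 ler_sqrt// ler1n.
pose f : {ffun 'I_p -> cell} := [ffun i => (v i 0 < 0, Ordinal (klt i))].
have fE i : lattice_point f i 0 = (-1) ^+ (v i 0 < 0)%R * (k i)%:R * step.
  by rewrite mxE ffunE.
have vE i : v i 0 = (-1) ^+ (v i 0 < 0)%R * `|v i 0|.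
  by case: ltrP => h; rewrite ?expr1 ?expr0; [rewrite ltr0_norm//|rewrite ger0_norm//]; ring.
have klev i : (k i)%:R * step <= `|v i 0|.
  by rewrite -ler_pdivlMr//; case/andP: (kP i).
have fsq i : lattice_point f i 0 ^+ 2 = ((k i)%:R * step) ^+ 2.
  by rewrite fE -mulrA exprMn sqrr_sign mul1r.
have vsum : \sum_i v i 0 ^+ 2 = 1.
  by transitivity (dotv v v); [apply: eq_bigr => i _; rewrite expr2|
    rewrite -sqr_norm2 v1 expr1n].
have ksum : \sum_i ((k i)%:R * step) ^+ 2 <= 1.
  apply: (@le_trans _ _ (\sum_i v i 0 ^+ 2)); last by rewrite vsum.
  apply: ler_sum => i _.
  rewrite -[leRHS]real_normK ?num_real// lerXn2r ?nnegrE ?mulr_ge0//.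
  exact: ltW.
exists (lattice_point f).
  apply/mapP; exists f => //; rewrite mem_enum inE; apply/andP; split.
    under eq_bigr do rewrite ffunE/=.
    rewrite -(ler_nat R) natr_sum natrM.
    apply: (@le_trans _ _ (\sum_i (k i)%:R ^+ 2)).
      apply: ler_sum => i _; rewrite -natrX ler_nat.
      by case: (k i) => // m; rewrite leq_pmulr.
    have s20 : 0 < step ^+ 2 by rewrite exprn_gt0.
    rewrite -(ler_pM2r s20) -mulrA stepE mulfV// mulr_suml.
    by under eq_bigr do rewrite -exprMn.
  rewrite /norm2 -sqrtr1 ler_sqrt// /dotv.
  by under eq_bigr do rewrite -expr2 fsq.
rewrite /norm2 /dotv -[leRHS]ger0_norm// -sqrtr_sqr ler_sqrt; last exact: sqr_ge0.
have -> : (4^-1 : R) ^+ 2 = \sum_(i < p) step ^+ 2.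
  rewrite sumr_const card_ord -[RHS]mulr_natl stepE; by field.
apply: ler_sum => i _; rewrite -expr2 !mxE ffunE/= [X in X - _]vE -mulrA -mulrBr.
rewrite exprMn sqrr_sign mul1r; apply: lerXn2r; rewrite ?nnegrE ?subr_ge0//.
  exact: ltW.
have /andP[_] := kP i; rewrite ltr_pdivrMr// -natr1 mulrDl mul1r => /ltW; lra.
Qed.

End LatticeNet.

(** * Subgaussian vectors and their covariance matrix *)

Section SubgaussianVectors.
Context {d : measure_display} {T : measurableType d} {R : realType} {p : nat}.
Variable P : probability T R.

Lemma measurable_dotv (u : 'cV[R]_p) :
  measurable_fun [set: borelV R p] (dotv u : borelV R p -> R).
Proof.
rewrite /dotv; apply: measurable_sum => i.
apply: measurable_funM => //; apply: (measurability _ (RGenOInfty.measurableE R)).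
move=> _ [_ [a ->] <-]; rewrite setTI; apply: sub_sigma_algebra.
apply: (@open_comp _ _ (fun v : 'cV[R]_p => v i 0)) => [v _|].
  exact: coord_continuous.
rewrite set_itvoy; exact: open_gt.
Qed.

Variables (y : {RV P >-> borelV R p}) (B : R).
Hypotheses (B0 : 0 < B) (y_centered : centered P y)
  (y_psi2 : (psi2v P y <= B%:E)%E).

(** The scale 2 B is used instead of B because the infimum that defines the
    psi_2-norm need not be attained. *)
Definition sqr_scaled (u : 'cV[R]_p) (v : borelV R p) : R :=
  dotv u v ^+ 2 / (2 * B) ^+ 2.

Lemma sqr_scaled_ge0 u v : 0 <= sqr_scaled u v.
Proof. by rewrite divr_ge0 ?sqr_ge0. Qed.

Lemma measurable_sqr_scaled u : measurable_fun setT (sqr_scaled u).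
Proof.
apply: measurable_funM => //; apply: measurable_funX; exact: measurable_dotv.
Qed.

(** By homogeneity, shrinking a unit vector u only decreases the square. *)
Lemma expR_sqr_scaled_le2 (u : 'cV[R]_p) : norm2 u <= 1 ->
  (\int[P]_w (expR (sqr_scaled u (y w)))%:E <= 2%:E)%E.
Proof.
move=> u1; have [u0|un0] := eqVneq (norm2 u) 0.
  rewrite (norm2_eq0 u0).
  under eq_integral do rewrite /sqr_scaled dotv0l expr0n/= mul0r expR0.
  by rewrite integral_cst//= probability_setT mule1 lee_fin ler1n.
have u0 : 0 < norm2 u by rewrite lt_def un0 norm2_ge0.
pose v := (norm2 u)^-1 *: u.
have v1 : norm2 v = 1 by rewrite norm2Z ger0_norm ?invr_ge0 ?norm2_ge0// mulVf.
have : (psi2 P (fun w => dotv v (y w)) < (2 * B)%:E)%E.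
  apply: (@le_lt_trans _ _ B%:E); last by rewrite lte_fin ltr_pMl// ltr1n.
  by apply: le_trans y_psi2; apply: ereal_sup_ubound; exists v.
move=> /ereal_inf_lt[_ [x [x0 Ex] <-]]; rewrite lte_fin => xB.
apply: le_trans Ex; rewrite unlock; apply: ge0_le_integral => //.
- apply/measurable_EFinP; apply: measurableT_comp => //.
  by apply: measurableT_comp => //; exact: measurable_sqr_scaled.
- apply/measurable_EFinP; apply: measurableT_comp => //.
  apply: measurable_funM => //; apply: measurable_funX.
  by apply: (measurableT_comp (measurable_dotv v)).
move=> w _; rewrite lee_fin ler_expR /sqr_scaled.
have -> : dotv u (y w) = norm2 u * dotv v (y w).
  by rewrite dotvZl mulrA divff ?mul1r.
rewrite exprMn; set z := dotv v (y w).
apply: (@le_trans _ _ (z ^+ 2 / (2 * B) ^+ 2)).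
  by rewrite ler_wpM2r ?invr_ge0 ?sqr_ge0// ler_piMl ?sqr_ge0// expr_le1 ?norm2_ge0.
rewrite ler_wpM2l ?sqr_ge0// lef_pV2 ?posrE ?exprn_gt0//; last lra.
by apply: lerXn2r; rewrite ?nnegrE; lra.
Qed.

Lemma integrable_sqr_dotv (u : 'cV[R]_p) : norm2 u <= 1 ->
  P.-integrable setT (fun w => (dotv u (y w) ^+ 2)%:E).
Proof.
move=> u1; have B2 : (2 * B) ^+ 2 != 0 by rewrite expf_neq0// mulf_neq0// gt_eqF.
rewrite (_ : (fun w => _) =
    (fun w => ((2 * B) ^+ 2)%:E * (sqr_scaled u (y w))%:E)%E).
  apply: integrableZl => //; apply: integrable_sub_expR.
  - exact: (measurableT_comp (measurable_sqr_scaled u)).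
  - by move=> w; exact: sqr_scaled_ge0.
  - exact: expR_sqr_scaled_le2.
by apply/funext => w; rewrite -EFinM mulrC divfK.
Qed.

(** The products of two coordinates are integrable because they are dominated by
    the sum of the squares of the coordinates; centering removes the means from
    the covariances. *)
Lemma quad_cov_matrix (u : 'cV[R]_p) :
  quad (cov_matrix P y) u = \int[P]_w (dotv u (y w) ^+ 2).
Proof.
have coordE i w : coordv y i w = dotv (delta_mx i 0) (y w).
  rewrite /dotv (bigD1 i)//= mxE !eqxx mul1r big1 ?addr0// => j ji.
  by rewrite mxE (negbTE ji) mul0r.
have icc i j : P.-integrable setT (EFin \o (fun w => coordv y i w * coordv y j w)).
  have nd k : norm2 (delta_mx k 0 : 'cV[R]_p) <= 1.
    rewrite /norm2 /dotv (bigD1 k)//= big1 => [|j' jk].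
      by rewrite mxE !eqxx mulr1 addr0 sqrtr1.
    by rewrite mxE (negbTE jk) mul0r.
  apply: (le_integrable measurableT _ _
    (integrableD measurableT (integrable_sqr_dotv (nd i)) (integrable_sqr_dotv (nd j)))).
    have mcoord k : measurable_fun setT (coordv y k).
      rewrite (_ : coordv y k = fun w => dotv (delta_mx k 0) (y w)).
        exact: (measurableT_comp (measurable_dotv _)).
      by apply/funext => w; exact: coordE.
    by apply/measurable_EFinP; exact: measurable_funM.
  move=> w _ /=; rewrite -!coordE lee_fin.
  rewrite [leRHS]ger0_norm ?addr_ge0 ?sqr_ge0// ler_norml; apply/andP.
  by split; set a := coordv y i w; set b := coordv y j w;
    have := sqr_ge0 (a + b); have := sqr_ge0 (a - b);
    have := sqr_ge0 a; have := sqr_ge0 b; rewrite !expr2; nra.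
have covE i j : cov_matrix P y i j = \int[P]_w (coordv y i w * coordv y j w).
  rewrite mxE unlock !y_centered unlock /Rintegral; congr fine.
  apply: eq_integral => w _ ; congr EFin.
  by rewrite -[LHS]/((coordv y i w - 0) * (coordv y j w - 0)) !subr0.
have sumE (s : seq ('I_p * 'I_p)) :
    P.-integrable setT (EFin \o (fun w => \sum_(c <- s) u c.1 0 * u c.2 0 *
      (coordv y c.1 w * coordv y c.2 w))) /\
    \int[P]_w (\sum_(c <- s) u c.1 0 * u c.2 0 *
      (coordv y c.1 w * coordv y c.2 w)) =
    \sum_(c <- s) u c.1 0 * u c.2 0 * cov_matrix P y c.1 c.2.
  elim: s => [|[i j] s [is_ IH]].
    split.
      under eq_fun do rewrite big_nil; exact: finite_measure_integrable_cst.
    under eq_Rintegral do rewrite big_nil.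
    by rewrite Rintegral_cst// mul0r big_nil.
  have i1 : P.-integrable setT (EFin \o
      (fun w => u i 0 * u j 0 * (coordv y i w * coordv y j w))).
    rewrite (_ : _ \o _ = (fun w => (u i 0 * u j 0)%:E *
      (coordv y i w * coordv y j w)%:E)%E)//.
    exact: (integrableZl measurableT _ (icc i j)).
  split.
    apply: eq_integrable (integrableD measurableT i1 is_) => // w _.
    by rewrite /= big_cons.
  under eq_Rintegral do rewrite big_cons.
  rewrite RintegralD// IH big_cons/= RintegralZl//.
  by congr (_ * _ + _); rewrite covE.
have -> : quad (cov_matrix P y) u = \sum_(c <- index_enum ('I_p * 'I_p)%type)
    u c.1 0 * u c.2 0 * cov_matrix P y c.1 c.2.
  rewrite -(pair_bigA _ (fun i j => u i 0 * u j 0 * cov_matrix P y i j))/=.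
  rewrite /quad /dotv; apply: eq_bigr => i _; rewrite mxE mulr_sumr.
  by apply: eq_bigr => j _; ring.
rewrite -(sumE _).2; apply: eq_Rintegral => w _.
rewrite -(pair_bigA _ (fun i j => u i 0 * u j 0 * (coordv y i w * coordv y j w)))/=.
rewrite expr2 /dotv mulr_suml; apply: eq_bigr => i _; rewrite mulr_sumr.
by apply: eq_bigr => j _; rewrite /coordv; ring.
Qed.

Lemma mean_sqr_scaled (u : 'cV[R]_p) : norm2 u <= 1 ->
  fine (\int[P]_w (sqr_scaled u (y w))%:E)%E =
  quad (cov_matrix P y) u / (2 * B) ^+ 2.
Proof.
move=> u1; rewrite quad_cov_matrix mulrC -RintegralZl//; last exact: integrable_sqr_dotv.
by rewrite /Rintegral; congr fine; apply: eq_integral => w _; rewrite mulrC.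
Qed.

Lemma quad_cov_matrix_bounds (u : 'cV[R]_p) : norm2 u <= 1 ->
  0 <= quad (cov_matrix P y) u <= 4 * B ^+ 2.
Proof.
move=> u1.
have := @mean_le1 _ _ _ P (fun w => sqr_scaled u (y w))
  (measurableT_comp (measurable_sqr_scaled u) (measurable_funPT y))
  (fun w => sqr_scaled_ge0 u (y w)) (expR_sqr_scaled_le2 u1).
rewrite mean_sqr_scaled//.
have B2 : 0 < (2 * B) ^+ 2 by rewrite exprn_gt0// mulr_gt0.
rewrite ler_pdivrMr// mul1r ler_pdivlMr// mul0r exprMn; lra.
Qed.

Lemma cov_matrix_sym : (cov_matrix P y)^T = cov_matrix P y.
Proof. by apply/matrixP => i j; rewrite !mxE covarianceC. Qed.

End SubgaussianVectors.

(** * Deviations of a sum of independent subexponential variables *)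

Section SubexponentialSums.
Context {d : measure_display} {T : measurableType d} {R : realType} {p n : nat}.
Variables (P : probability T R) (y : nat -> {RV P >-> borelV R p}).
Hypothesis y_indep : mutually_independent P n (fun t => y t).
Variable h : borelV R p -> R.
Hypotheses (mh : measurable_fun setT h) (h0 : forall v, 0 <= h v)
  (Eh : forall t, (1 <= t <= n)%N ->
     (\int[P]_w (expR (h (y t w)))%:E <= 2%:E)%E).

Let mean t := fine (\int[P]_w (h (y t w))%:E).

Let deviation (s : seq nat) w := \sum_(t <- s) (h (y t w) - mean t).

Lemma measurable_deviation s : measurable_fun setT (deviation s).
Proof.
rewrite /deviation; apply: measurable_sum => t.
by apply: measurable_funB => //; exact: measurableT_comp.
Qed.

Let measurable_ge (X : T -> R) x :
  measurable_fun setT X -> measurable [set w | x <= X w].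
Proof.
move=> mX; have -> : [set w | x <= X w] = X @^-1` `[x, +oo[.
  by apply/seteqP; split => w /=; rewrite in_itv/= andbT.
by rewrite -[X in measurable X]setTI; exact: mX.
Qed.

Let measurable_tail s sg x : measurable [set w | x <= sg * deviation s w].
Proof. by apply: measurable_ge; exact/measurable_funM/measurable_deviation. Qed.

Lemma measurable_abs_deviation s x : measurable [set w | x <= `|deviation s w|].
Proof.
by apply: measurable_ge; apply: measurableT_comp => //; exact: measurable_deviation.
Qed.

(** Chernoff bound; sg = 1 and sg = -1 give the two tails. With r terms, the
    exponent is - theta x + 32 r theta^2. *)
Lemma subexponential_tail (s : seq nat) (sg u : R) :
  uniq s -> (forall t, t \in s -> (1 <= t <= n)%N) -> (0 < size s)%N ->
  `|sg| <= 1 -> 0 <= u ->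
  (P [set w | (18 * (Num.sqrt ((size s)%:R * u) + u) <= sg * deviation s w)%R]
     <= (expR (- u))%:E)%E.
Proof.
move=> us sn s0 sg1 u0; set r : R := (size s)%:R.
have r0 : 0 < r by rewrite ltr0n.
set a := Num.sqrt u; set b := Num.sqrt r.
have a0 : 0 <= a by exact: sqrtr_ge0.
have b0 : 0 < b by rewrite sqrtr_gt0.
have aE : u = a ^+ 2 by rewrite sqr_sqrtr.
have bE : r = b ^+ 2 by rewrite sqr_sqrtr// ltW.
rewrite sqrtrM ?(ltW r0)// -/a -/b.
(* This choice of theta is at most 1 / 2, and it interpolates between the optimal
   values sqrt (u / r) / 2 for u <= r and 1 / 2 for u >= r: then theta x = 9 u and
   32 r theta^2 <= 8 u. *)
pose th := a / (2 * (b + a)).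
have th0 : 0 <= th by rewrite divr_ge0//; lra.
have th1 : th <= 2^-1 by rewrite ler_pdivrMr; lra.
have thE : th * (2 * (b + a)) = a by rewrite divfK//; apply/eqP; lra.
have absth : `|th * sg| <= 2^-1.
  rewrite normrM (ger0_norm th0); apply: le_trans th1.
  by rewrite ler_piMr.
have [u_eq0|un0] := eqVneq u 0.
  by rewrite u_eq0 oppr0 expR0; apply: probability_le1; exact: measurable_tail.
have a_gt0 : 0 < a by rewrite sqrtr_gt0 lt_def un0.
have th_gt0 : 0 < th by rewrite divr_gt0//; lra.
have -> : [set w | (18 * (b * a + u) <= sg * deviation s w)%R] =
    [set w | (9 * u <= th * sg * deviation s w)%R].
  apply/funext => w; rewrite /mkset -(ler_pM2l th_gt0) [in leRHS]mulrA.
  congr (is_true (_ <= _)).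
  rewrite aE; transitivity (9 * a * (th * (2 * (b + a)))); first by ring.
  by rewrite thE; ring.
have mdev : measurable_fun setT (fun w => th * sg * deviation s w).
  exact/measurable_funM/measurable_deviation.
apply: le_trans (exponential_markov _ _ mdev) _.
pose e t := fine (\int[P]_w (expR (th * sg * (h (y t w) - mean t)))%:E).
have mS t : measurable_fun setT (fun w => h (y t w)) by exact: measurableT_comp.
have mgf t : t \in s -> (\int[P]_w (expR (th * sg * (h (y t w) - mean t)))%:E
    <= (expR (32 * (th * sg) ^+ 2))%:E)%E.
  by move=> /sn/Eh Eht; exact: centered_mgf_le.
have eE t : t \in s ->
    (\int[P]_w (expR (th * sg * (h (y t w) - mean t)))%:E)%E = (e t)%:E.
  move=> ts; rewrite fineK// ge0_fin_numE ?integral_ge0//.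
  exact: le_lt_trans (mgf t ts) (ltry _).
have -> : (\int[P]_w (expR (th * sg * deviation s w))%:E = (\prod_(t <- s) e t)%:E)%E.
  rewrite -(integral_prod_independent y_indep
    (f := fun t v => expR (th * sg * (h v - mean t))))//; last first.
  - move=> t; apply: measurableT_comp => //; apply: measurable_funM => //.
    exact: measurable_funB.
  apply: eq_integral => w _; congr EFin; rewrite /deviation mulr_sumr.
  by rewrite (big_morph expR (@expRD R) (@expR0 R)).
have prod_le : \prod_(t <- s) e t <= expR (8 * u).
  apply: (@le_trans _ _ (\prod_(t <- s) expR (32 * (th * sg) ^+ 2))).
    rewrite !big_seq; apply: ler_prod => t ts.
    apply/andP; split; rewrite -lee_fin -(eE t ts) ?mgf//.
    by rewrite integral_ge0.
  rewrite big_const_seq count_predT iter_mulr_1 -expRM_natr ler_expR -/r bE aE.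
  have tb : th * b <= a / 2 by nra.
  have tb2 : (th * b) ^+ 2 <= (a / 2) ^+ 2.
    by apply: lerXn2r; rewrite ?nnegrE//; [exact: mulr_ge0 (ltW b0)|lra].
  have sg2 : sg ^+ 2 <= 1 by rewrite -real_normK ?num_real// expr_le1.
  have := ler_pM (sqr_ge0 _) (sqr_ge0 _) tb2 sg2.
  by rewrite !exprMn exprVn; lra.
rewrite -EFinM lee_fin; apply: le_trans (ler_wpM2l (expR_ge0 _) prod_le) _.
by rewrite -expRD ler_expR; lra.
Qed.

Lemma subexponential_deviation (s : seq nat) (u : R) :
  uniq s -> (forall t, t \in s -> (1 <= t <= n)%N) -> (0 < size s)%N -> 0 <= u ->
  (P [set w | (18 * (Num.sqrt ((size s)%:R * u) + u) <= `|deviation s w|)%R]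
     <= (2 * expR (- u))%:E)%E.
Proof.
move=> us sn s0 u0; set x := 18 * _.
apply: (@le_trans _ _ (P ([set w | (x <= 1 * deviation s w)%R] `|`
    [set w | (x <= -1 * deviation s w)%R]))).
  apply: le_measure; rewrite ?inE.
  - exact: measurable_abs_deviation.
  - by apply: measurableU; exact: measurable_tail.
  - move=> w /=; rewrite mul1r mulN1r.
    by have [d0|d0] := leP 0 (deviation s w);
      [rewrite ger0_norm//; left|rewrite ltr0_norm//; right].
apply: le_trans (measureU2 _ (measurable_tail _ _ _) (measurable_tail _ _ _)) _.
rewrite (_ : 2 * _ = expR (- u) + expR (- u))%R; last by ring.
by rewrite EFinD leeD// subexponential_tail// ?normrN normr1.
Qed.
End SubexponentialSums.

(** * Uniform control of the empirical covariances over the grid *)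

Section UnionBound.
Context {d : measure_display} {T : measurableType d} {R : realType}.
Variable P : probability T R.

Lemma measurable_bigsetU_seq (I : Type) (s : seq I) (F : I -> set T) :
  (forall i, measurable (F i)) -> measurable (\big[setU/set0]_(i <- s) F i).
Proof.
move=> mF; elim: s => [|i s IH]; first by rewrite big_nil.
by rewrite big_cons; exact: measurableU.
Qed.

Lemma union_bound (I : Type) (s : seq I) (F : I -> set T) (b : I -> R) :
  (forall i, measurable (F i)) -> (forall i, 0 <= b i) ->
  (forall i, (P (F i) <= (b i)%:E)%E) ->
  (P (\big[setU/set0]_(i <- s) F i) <= (\sum_(i <- s) b i)%:E)%E.
Proof.
move=> mF b0 Fb; elim: s => [|i s IH]; first by rewrite !big_nil measure0.
rewrite !big_cons EFinD; apply: le_trans (measureU2 _ _ _) _ => //.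
  exact: measurable_bigsetU_seq.
exact: leeD (Fb i) IH.
Qed.

End UnionBound.

Definition log_term {R : realType} (delta : R) (n r : nat) : R :=
  ln (2 * n%:R / (delta * r%:R)).

(** First indices of the averaging windows of length r: the windows on both sides
    of a location of the grid start at a multiple of r / 2 (plus one) or are tied to
    the last location n - r + 1. Their number is of order n / r, which is what the
    union bound needs; the maximum with 1 handles r = 1. *)
Definition window_starts (n r : nat) : seq nat :=
  [:: (n - r + 1)%N, (n - r - r + 1)%N &
   [seq (m * maxn 1 (r %/ 2) + 1)%N | m <- iota 0 ((2 * n) %/ r)]].

Definition window_error {R : realType} {p : nat} (x : nat -> 'cV[R]_p)
    (Sigma : nat -> 'M[R]_p) (a r : nat) : 'M[R]_p :=
  r%:R^-1 *: \sum_(a <= t < a + r) (x t *m (x t)^T - Sigma t).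

Lemma sum_pow2_le m : (\sum_(j <- iota 0 m) 2 ^ j <= 2 ^ m)%N.
Proof.
elim: m => [|m IH]; first by rewrite big_nil.
by rewrite -addn1 iotaD big_cat/= big_seq1 add0n addn1 expnS mul2n -addnn leq_add.
Qed.

Lemma net_exponential_le {R : realType} (p N : nat) (m : R) : (0 < p)%N ->
  N%:R <= (2 ^+ 18) ^+ p :> R ->
  N%:R * expR (- (20 * (p%:R + m))) <= 4^-1 * expR (- m) ^+ 20.
Proof.
move=> p_gt0 Nsize.
rewrite mulrDr opprD expRD mulrA.
have -> : expR (- (20 * m)) = expR (- m) ^+ 20.
  by rewrite -expRM_natl; congr expR; ring.
rewrite ler_wpM2r ?exprn_ge0 ?expR_ge0//.
have -> : expR (- (20 * p%:R)) = (expR 1 ^+ 20)^-1 ^+ p :> R.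
  by rewrite exprVn -exprM expRN -expRM_natl natrM mulr1.
apply: (@le_trans _ _ ((2 ^+ 18) ^+ p * ((2 ^+ 20)^-1) ^+ p)).
  have e0 : 0 <= (expR 1 ^+ 20)^-1 :> R by rewrite invr_ge0 exprn_ge0 ?expR_ge0.
  have e1 : (expR 1 ^+ 20)^-1 <= (2 ^+ 20)^-1 :> R.
    rewrite lef_pV2 ?posrE ?exprn_gt0 ?expR_gt0//.
    apply: lerXn2r; rewrite ?nnegrE ?expR_ge0//.
    by have := @expR_ge1Dx R 1; lra.
  apply: ler_pM => //.
  by apply: lerXn2r => //; rewrite nnegrE invr_ge0 exprn_ge0.
rewrite -exprMn (_ : 2 ^+ 18 / 2 ^+ 20 = 4^-1 :> R); last by field.
case: p p_gt0 {Nsize} => // p' _; rewrite exprS ler_piMr//.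
by rewrite exprn_ile1//; lra.
Qed.

Section DeviationEvent.
Context {d : measure_display} {T : measurableType d} {R : realType} {p n : nat}.
Variables (P : probability T R) (y : nat -> {RV P >-> borelV R p}) (B delta : R).
Hypotheses (p_gt0 : (0 < p)%N) (B0 : 0 < B) (delta01 : 0 < delta < 1).
Hypothesis y_indep : mutually_independent P n (fun t => y t).
Hypothesis y_centered : forall t, (1 <= t <= n)%N -> centered P (y t).
Hypothesis y_psi2 : forall t, (1 <= t <= n)%N -> (psi2v P (y t) <= B%:E)%E.

Let Sigma t := cov_matrix P (y t).

Let error a r w := window_error (fun t => y t w : 'cV[R]_p) Sigma a r.

Let sq u w t : R := sqr_scaled B u (y t w) - fine (\int[P]_w (sqr_scaled B u (y t w))%:E).

Let quad_outer (u v : 'cV[R]_p) : quad (v *m v^T) u = dotv u v ^+ 2.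
Proof.
rewrite /quad -mulmxA [X in _ *m X](_ : _ = (dotv v u)%:M).
  by rewrite mul_mx_scalar dotvZr dotvC expr2.
by rewrite [LHS]mx11_scalar dotvE.
Qed.

Let quad_sum (s : seq nat) (F : nat -> 'M[R]_p) u :
  quad (\sum_(t <- s) F t) u = \sum_(t <- s) quad (F t) u.
Proof.
apply: (big_morph (fun A => quad A u)) => [A1 A2|].
  by rewrite /quad mulmxDl dotvDr.
by rewrite /quad mul0mx dotvC dotv0l.
Qed.

Let window_in a r t : (1 <= a)%N -> (a + r <= n.+1)%N ->
  t \in index_iota a (a + r) -> (1 <= t <= n)%N.
Proof.
move=> a1 arn; rewrite mem_index_iota => /andP[h1 h2].
by rewrite (leq_trans a1 h1) -ltnS (leq_trans h2).
Qed.

Let quad_error a r w u : (1 <= a)%N -> (a + r <= n.+1)%N ->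
  norm2 u <= 1 ->
  quad (error a r w) u =
  r%:R^-1 * ((2 * B) ^+ 2 * \sum_(t <- index_iota a (a + r)) sq u w t).
Proof.
move=> a1 arn u1; rewrite quadZ quad_sum; congr (_ * _).
rewrite mulr_sumr; apply: eq_big_seq => t ts.
have tn := window_in a1 arn ts.
rewrite quadB quad_outer /sq (mean_sqr_scaled B0 (y_centered tn) (y_psi2 tn) u1).
have B2 : (2 * B) ^+ 2 != 0 by rewrite expf_neq0// mulf_neq0// gt_eqF.
by rewrite mulrBr !(mulrC ((2 * B) ^+ 2)) !divfK.
Qed.

(* The constant 20 lets e^(- 20 p) beat the size 2^(18 p) of the net with a factor
   at most 1 / 4 left, while e^(- 20 L) is at most (delta r / 2 n)^2. *)
Let level r : R := 20 * (p%:R + log_term delta n r).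

(* The conditions that make subexponential_deviation applicable are put in the
   event, so that its probability is bounded for all indices. *)
Let bad (r a : nat) (u : 'cV[R]_p) : set T :=
  if [&& (0 < r)%N, (1 <= a)%N, (a + r <= n.+1)%N, norm2 u <= 1 & 0 <= level r]
  then [set w | 18 * (Num.sqrt (r%:R * level r) + level r) <=
    `|\sum_(t <- index_iota a (a + r)) sq u w t|]
  else set0.

Let measurable_bad r a u : measurable (bad r a u).
Proof.
rewrite /bad; case: ifP => _ //.
by apply: measurable_abs_deviation; exact: measurable_sqr_scaled.
Qed.

Let bad_le r a u : (P (bad r a u) <= (2 * expR (- level r))%:E)%E.
Proof.
rewrite /bad; case: ifPn => [/and5P[r0 a1 arn u1 l0]|_]; last first.
  by rewrite measure0 lee_fin mulr_ge0 ?expR_ge0.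
have sz : size (index_iota a (a + r)) = r by rewrite size_iota addKn.
rewrite -{1}sz; apply: subexponential_deviation => //.
- exact: y_indep.
- exact: measurable_sqr_scaled.
- by move=> v; exact: sqr_scaled_ge0.
- by move=> t tn; apply: expR_sqr_scaled_le2 => //; exact: y_psi2.
- exact: iota_uniq.
- by move=> t; exact: window_in.
- by rewrite sz.
Qed.

Let error_sym a r w : (error a r w)^T = error a r w.
Proof.
rewrite /error /window_error linearZ/= linear_sum/=; congr (_ *: _).
apply: eq_bigr => t _.
by rewrite linearB/= trmx_mul trmxK cov_matrix_sym.
Qed.

(** At scale r there are at most 3 n / r windows, and each fails with probability at
    most (delta r / 2 n)^2 / 2 after the union over the net. The scales being powers
    of 2, the sum over r of the total failure (3 / 8) delta^2 r / n is dominated by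
    its last terms and is smaller than delta / 2. The event is defined by finitely
    many continuous functions of the observations, hence it is measurable. *)
Lemma deviation_event : (2 <= n)%N -> exists E : set T,
  [/\ measurable E, ((1 - delta)%:E < P E)%E &
  forall w, E w -> forall j a, (j < nb_scales n)%N ->
    (a + 2 ^ j <= n.+1)%N -> a \in window_starts n (2 ^ j) ->
    opnorm (window_error (fun t => y t w : 'cV[R]_p)
        (fun t => cov_matrix P (y t)) a (2 ^ j))
      <= @threshold R p 11520 B delta n (2 ^ j) / 4].
Proof.
move=> n2; have [N Nnet Nsize] := @exists_net R p p_gt0.
have [d0 d1] := andP delta01.
have n0 : 0 < n%:R :> R by rewrite ltr0n (leq_trans _ n2).
have scale_le j : (j < nb_scales n)%N -> (2 * 2 ^ j <= n)%N.
  move=> jn; rewrite -expnS (leq_trans _ (trunc_logP (isT : (1 < 2)%N) (leq_trans _ n2)))//.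
  by rewrite leq_exp2l.
have scale0 j : 0 < (2 ^ j)%:R :> R by rewrite ltr0n expn_gt0.
have log_gt0 j : (j < nb_scales n)%N -> 0 < log_term delta n (2 ^ j).
  move=> /scale_le jn; apply: ln_gt0; rewrite ltr_pdivlMr ?mulr_gt0// mul1r.
  have : (2 * 2 ^ j)%:R <= n%:R :> R by rewrite ler_nat.
  rewrite natrM; have := scale0 j; nra.
pose Bad := \big[setU/set0]_(j <- iota 0 (nb_scales n))
  \big[setU/set0]_(a <- window_starts n (2 ^ j))
  \big[setU/set0]_(u <- N) bad (2 ^ j) a u.
have mBad : measurable Bad.
  by do 3 (apply: measurable_bigsetU_seq => ?).
exists (~` Bad); split; first exact: measurableC.
  have PBad : (P Bad <= (2^-1 * delta)%:E)%E.
    pose bound j : R := (size (window_starts n (2 ^ j)))%:R *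
      ((size N)%:R * (2 * expR (- level (2 ^ j)))).
    apply: (@le_trans _ _ (\sum_(j <- iota 0 (nb_scales n)) bound j)%:E).
      have bound_ge0 r : 0 <= 2 * expR (- level r) by rewrite mulr_ge0 ?expR_ge0.
      apply: union_bound => [j|j|j]; first by do 2 (apply: measurable_bigsetU_seq => ?).
        by rewrite !mulr_ge0.
      have -> : bound j = \sum_(a <- window_starts n (2 ^ j))
          \sum_(u <- N) 2 * expR (- level (2 ^ j)).
        rewrite !big_const_seq !count_predT !iter_addr_0 /bound.
        by rewrite -[RHS]mulr_natl -[in RHS](mulr_natl _ (size N)).
      apply: union_bound => [a|a|a]; first exact: measurable_bigsetU_seq.
        by apply: sumr_ge0.
      by apply: union_bound.
    rewrite lee_fin.
    apply: (@le_trans _ _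
        (\sum_(j <- iota 0 (nb_scales n)) 2^-1 * delta * n%:R^-1 * (2 ^ j)%:R)).
      rewrite !big_seq; apply: ler_sum => j; rewrite mem_iota/= add0n => jn.
      have h2 : (2 * 2 ^ j)%:R <= n%:R :> R by rewrite ler_nat scale_le.
      have r0 := scale0 j; rewrite natrM in h2.
      have size_le : (size (window_starts n (2 ^ j)))%:R * (2 ^ j)%:R <= 3 * n%:R :> R.
        rewrite -!natrM ler_nat /= size_map size_iota.
        have := leq_divM (2 * n) (2 ^ j); have := scale_le j jn; lia.
      rewrite /bound; set r := (2 ^ j)%N in h2 r0 size_le *.
      move: size_le; set S : R := (size _)%:R => size_le.
      pose q := delta * r%:R / (2 * n%:R).
      have qE : expR (- log_term delta n r) = q.
        by rewrite expRN /log_term lnK ?posrE ?divr_gt0 ?mulr_gt0// invf_div.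
      have q0 : 0 <= q by rewrite divr_ge0 ?mulr_ge0// ltW.
      have q1 : q <= 1 by rewrite ler_pdivrMr ?mulr_gt0//; nra.
      have := net_exponential_le (log_term delta n r) p_gt0 Nsize.
      rewrite -/(level r) qE => net_le'.
      have q20 : q ^+ 20 <= q ^+ 2 by rewrite ler_wiXn2l.
      apply: (@le_trans _ _ (S * (2 * (4^-1 * q ^+ 2)))).
        rewrite ler_wpM2l// [in leLHS]mulrCA ler_wpM2l// (le_trans net_le')//.
        by rewrite ler_wpM2l.
      have -> : S * (2 * (4^-1 * q ^+ 2)) =
          8^-1 * delta ^+ 2 * (n%:R ^+ 2)^-1 * r%:R * (S * r%:R).
        by rewrite /q; field; lra.
      have n20 : 0 < n%:R ^+ 2 :> R by rewrite exprn_gt0.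
      apply: (@le_trans _ _ (8^-1 * delta ^+ 2 * (n%:R ^+ 2)^-1 * r%:R * (3 * n%:R))).
        apply: ler_wpM2l => //; apply: mulr_ge0 (ltW r0); apply: mulr_ge0.
          by rewrite mulr_ge0 ?sqr_ge0.
        by rewrite invr_ge0 ltW.
      have -> : 8^-1 * delta ^+ 2 * (n%:R ^+ 2)^-1 * r%:R * (3 * n%:R) =
          (3 / 8 * delta ^+ 2) * (n%:R^-1 * r%:R) by field; lra.
      rewrite -[leRHS]mulrA ler_wpM2r//; nra.
    rewrite -mulr_sumr -natr_sum.
    have : (\sum_(j <- iota 0 (nb_scales n)) 2 ^ j)%:R <= n%:R :> R.
      by rewrite ler_nat (leq_trans (sum_pow2_le _))// trunc_logP// (leq_trans _ n2).
    move=> h; rewrite -[leRHS]mulr1 -mulrA ler_wpM2l//; first lra.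
    by rewrite mulrC ler_pdivrMr// mul1r.
  have PBfin : P Bad \is a fin_num by exact: fin_num_measure.
  rewrite probability_setC// -(fineK PBfin) -EFinB lte_fin.
  by move: PBad; rewrite -(fineK PBfin) lee_fin; lra.
move=> w nBad j a jn arn aw.
have l0 : 0 <= level (2 ^ j) by rewrite mulr_ge0// addr_ge0// ltW// log_gt0.
have a1 : (1 <= a)%N.
  by move: aw; rewrite !inE => /or3P[/eqP->|/eqP->|/mapP[m _ ->]]; rewrite addn1.
set r := (2 ^ j)%N in arn aw l0 *.
have r0 : 0 < r%:R :> R by exact: scale0.
have quad_le u : u \in N -> `|quad (error a r w) u| <=
    r%:R^-1 * ((2 * B) ^+ 2 * (18 * (Num.sqrt (r%:R * level r) + level r))).
  move=> uN; have u1 := Nnet.1 u uN.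
  rewrite quad_error// normrM ger0_norm ?invr_ge0 ?(ltW r0)//.
  rewrite ler_wpM2l ?invr_ge0 ?(ltW r0)// normrM ger0_norm ?sqr_ge0//.
  rewrite ler_wpM2l ?sqr_ge0// leNgt; apply/negP => h; apply: nBad.
  rewrite /Bad -bigcup_seq; exists j; first by rewrite /= mem_iota.
  rewrite -bigcup_seq; exists a => //.
  rewrite -bigcup_seq; exists u => //.
  rewrite /bad ifT; first exact: ltW.
  by apply/and5P; split => //; rewrite expn_gt0.
apply: le_trans (opnorm_le_net (error_sym a r w) _ Nnet quad_le) _.
  have h : 0 <= Num.sqrt (r%:R * level r) + level r by rewrite addr_ge0 ?sqrtr_ge0.
  by rewrite mulr_ge0 ?invr_ge0 ?(ltW r0)// mulr_ge0 ?sqr_ge0// mulr_ge0.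
rewrite /threshold -/(log_term delta n r).
set Q := log_term delta n r / r%:R; set p' : R := p%:R / r%:R.
have Q0 : 0 <= Q by rewrite divr_ge0// ltW// log_gt0.
have p'0 : 0 <= p' by rewrite divr_ge0.
have lE : level r = r%:R * (20 * (p' + Q)).
  rewrite /level /p' /Q; field; lra.
(* the level is r times a quantity of the form of the bracket in the threshold *)
have rK : r%:R^-1 * (Num.sqrt (r%:R * level r) + level r) =
    Num.sqrt (20 * (p' + Q)) + 20 * (p' + Q).
  rewrite lE mulrA -expr2 sqrtrM ?sqr_ge0// sqrtr_sqr ger0_norm ?(ltW r0)//.
  by field; lra.
have sqrt_le : Num.sqrt (20 * (p' + Q)) <= 20 * (Num.sqrt p' + Num.sqrt Q).
  have := sqrtr_ge0 p'; have := sqrtr_ge0 Q.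
  have := sqr_sqrtr p'0; have := sqr_sqrtr Q0.
  move: (Num.sqrt p') (Num.sqrt Q) => x z zE xE z0 x0.
  have s0 : 0 <= 20 * (x + z) by lra.
  rewrite -[leRHS]ger0_norm// -sqrtr_sqr ler_sqrt ?sqr_ge0//.
  by rewrite -zE -xE; nra.
have -> : 2 * (r%:R^-1 * ((2 * B) ^+ 2 * (18 * (Num.sqrt (r%:R * level r) + level r))))
    = 144 * B ^+ 2 * (Num.sqrt (20 * (p' + Q)) + 20 * (p' + Q)).
  by rewrite -rK; ring.
apply: (@le_trans _ _ (144 * B ^+ 2 *
    (20 * (Num.sqrt p' + Num.sqrt Q) + 20 * (p' + Q)))).
  by apply: ler_wpM2l; [rewrite mulr_ge0 ?sqr_ge0|rewrite lerD2r].
by rewrite le_eqVlt; apply/orP; left; apply/eqP; field.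
Qed.

End DeviationEvent.

(** * The scale at which a change-point is detected *)

Section ScaleSelection.
Context {R : realType}.
Implicit Types (a delta kappa : R) (n p s : nat).

Lemma ln_le_sqrt (S X : R) : 0 < S -> S ^+ 2 <= X -> ln X <= 2 * (X / S).
Proof.
move=> S0 SX; have X0 : 0 < X by apply: lt_le_trans SX; rewrite exprn_gt0.
have q0 : 0 < Num.sqrt X by rewrite sqrtr_gt0.
have qE : X = Num.sqrt X ^+ 2 by rewrite sqr_sqrtr// ltW.
have Sq : S <= Num.sqrt X.
  by rewrite -(ler_pXn2r (isT : (0 < 2)%N)) ?nnegrE ?(ltW S0) ?(ltW q0)// -qE.
have -> : ln X = 2 * ln (Num.sqrt X) by rewrite {1}qE lnXn// mulr_natl.
rewrite ler_wpM2l//.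
apply: le_trans (ltW (ln_sublinear q0)) _.
by rewrite ler_pdivlMr// {2}qE expr2 ler_wpM2l// ltW.
Qed.

Lemma log_termB delta n r : 0 < delta -> (0 < n)%N -> (0 < r)%N ->
  log_term delta n r = ln (2 * n%:R / delta) - ln (r%:R : R).
Proof.
move=> d0 n0 r0; rewrite /log_term invfM mulrA ln_div// posrE.
  by rewrite divr_gt0// mulr_gt0// ltr0n.
by rewrite ltr0n.
Qed.

(** Here a stands for the squared jump divided by B^4, s for the spacing. The
    selected scale is the least power of 2 at which the energy condition, with the
    constant kappa, holds. Failure of the condition at half this scale gives the
    upper bound by the localization rate, because the selected scale is at least
    2 / a, which turns 2 n / (delta r) into n a / delta. The bound of the rate by
    s / 4 comes from ln (s a) <= 2 s a / S as soon as s a >= S^2, with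
    S = 32 kappa. *)
Lemma scale_selection a delta kappa n p s :
  0 < delta < 1 -> 0 < a <= 16 -> 16 < kappa -> (0 < p)%N -> (0 < s)%N ->
  (2 * s <= n)%N ->
  (32 * kappa) ^+ 2 * (p%:R + log_term delta n s) <= s%:R * a ->
  let rate := 2 * kappa * ((p%:R + ln (2 * delta^-1 * n%:R * a)) / a) in
  rate <= s%:R / 4 /\
  exists j, [/\ (0 < j)%N,
    kappa * (p%:R + log_term delta n (2 ^ j)) <= (2 ^ j)%:R * a &
    (2 ^ j)%:R <= rate].
Proof.
move=> /andP[d0 d1] /andP[a0 a16] k16 p0 s0 sn energy rate.
have n0 : (0 < n)%N by apply: leq_trans sn; rewrite muln_gt0.
have nR : 0 < n%:R :> R by rewrite ltr0n.
have sR : 0 < s%:R :> R by rewrite ltr0n.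
have pR : 1 <= p%:R :> R by rewrite ler1n.
have rR j : 0 < (2 ^ j)%:R :> R by rewrite ltr0n expn_gt0.
pose Z := ln (2 * n%:R / delta).
have log_ge0 r : (0 < r)%N -> (r <= 2 * n)%N -> 0 <= log_term delta n r.
  move=> r0 rn; apply: ln_ge0; rewrite ler_pdivlMr ?mulr_gt0 ?ltr0n// mul1r.
  rewrite -natrM; apply: le_trans (_ : r%:R <= _); last by rewrite ler_nat.
  by rewrite ler_piMl// ltW.
have sn' : (s <= n)%N by apply: leq_trans sn; exact: leq_pmull.
have Ls : 0 <= log_term delta n s.
  by apply: log_ge0 => //; apply: leq_trans sn' _; exact: leq_pmull.
set X := s%:R * a in energy.
have X0 : 0 < X by rewrite mulr_gt0.
have SX : (32 * kappa) ^+ 2 <= X.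
  apply: le_trans energy; rewrite ler_peMr ?sqr_ge0//; lra.
have S0 : 0 < 32 * kappa by lra.
have rate_le : rate <= s%:R / 4.
  have lnE : ln (2 * delta^-1 * n%:R * a) = log_term delta n s + ln X.
    rewrite log_termB// /X lnM ?posrE// addrA subrK -lnM ?posrE ?divr_gt0 ?mulr_gt0//.
    by congr ln; ring.
  have h1 : p%:R + log_term delta n s <= X / (32 * kappa).
    rewrite ler_pdivlMr// mulrC; apply: le_trans energy.
    rewrite expr2 -mulrA ler_peMl//; last lra.
    by rewrite mulr_ge0 ?(ltW S0)//; lra.
  have h2 := ln_le_sqrt S0 SX.
  have h3 : p%:R + ln (2 * delta^-1 * n%:R * a) <= 3 * (X / (32 * kappa)).
    by rewrite lnE; lra.
  rewrite /rate mulrA ler_pdivrMr//.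
  apply: (@le_trans _ _ (2 * kappa * (3 * (X / (32 * kappa))))).
    by rewrite ler_wpM2l//; lra.
  have -> : 2 * kappa * (3 * (X / (32 * kappa))) = 6 / 32 * X by field; lra.
  have -> : s%:R / 4 * a = X / 4 by rewrite /X; ring.
  lra.
split=> //.
(* the energy condition holds at all scales at least the spacing, hence a least
   scale exists and is smaller than twice the spacing *)
have large_scale r : (s <= r)%N -> kappa * (p%:R + log_term delta n r) <= X.
  move=> sr; apply: le_trans energy.
  have lr : log_term delta n r <= log_term delta n s.
    have r0 : (0 < r)%N by exact: leq_trans sr.
    by rewrite !log_termB// lerD2l lerN2 ler_ln ?posrE ?ltr0n ?ler_nat.
  apply: (@le_trans _ _ (kappa * (p%:R + log_term delta n s))).
    by rewrite ler_wpM2l ?lerD2l//; lra.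
  apply: ler_wpM2r; first lra.
  by rewrite expr2; nra.
have ex : exists j, kappa * (p%:R + log_term delta n (2 ^ j)) <= (2 ^ j)%:R * a.
  exists s; apply: (@le_trans _ _ X); last first.
    by rewrite ler_wpM2r ?(ltW a0)// ler_nat ltnW// ltn_expl.
  by apply: large_scale; rewrite // ltnW// ltn_expl.
case: (ex_minnP ex) => -[|i] Pj jmin.
  exfalso; move: Pj; rewrite expn0 mul1r.
  by have := log_ge0 1%N isT ltac:(by rewrite muln_gt0); nra.
have is_ : (2 ^ i < s)%N.
  rewrite ltnNge; apply/negP => si.
  have : (i.+1 <= i)%N by apply: jmin; apply: le_trans (large_scale _ si) _;
    rewrite ler_wpM2r ?(ltW a0)// ler_nat.
  by rewrite ltnn.
have rn : (2 ^ i.+1 <= 2 * n)%N 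
  by rewrite expnS leq_mul2l /= ltnW// (leq_trans is_).
have Lj := log_ge0 _ (ltac:(by rewrite expn_gt0) : (0 < 2 ^ i.+1)%N) rn.
have ra : 2 <= (2 ^ i.+1)%:R * a by apply: le_trans Pj; nra.
have nPi : (2 ^ i)%:R * a <= kappa * (p%:R + log_term delta n (2 ^ i)).
  rewrite leNgt; apply/negP => /ltW /jmin; by rewrite ltnn.
exists i.+1; split=> //; rewrite /rate mulrA ler_pdivlMr//.
have -> : (2 ^ i.+1)%:R * a = 2 * ((2 ^ i)%:R * a) by rewrite expnS natrM mulrA.
rewrite -mulrA ler_wpM2l//; apply: le_trans nPi _.
rewrite ler_wpM2l//; first lra.
rewrite lerD2l ler_ln ?posrE ?divr_gt0 ?mulr_gt0 ?invr_gt0//.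
rewrite ler_pdivrMr ?mulr_gt0//.
have -> : 2 * delta^-1 * n%:R * a * (delta * (2 ^ i)%:R) =
    n%:R * ((2 ^ i.+1)%:R * a) by rewrite expnS natrM; field; lra.
by rewrite mulrC ler_wpM2l// ltW.
Qed.

End ScaleSelection.

(** * Connected components of the detection region *)

Section Components.
Context {R : realType} {p : nat}.
Variables (c0 B delta : R) (n : nat) (x : nat -> 'cV[R]_p).

Let region := detection_region c0 B delta n x.
Let cov := covered c0 B delta n x.
Let kept_at j l := kept c0 B delta n x (2 ^ j) (cov j) l.

Lemma coveredP j t :
  cov j t <-> exists i l, [/\ (i < j)%N, kept_at i l & seg l (2 ^ i) t].
Proof.
elim: j => [|j IH]; first by split=> // -[i [l []]].
split.
  rewrite /cov /= => -[/IH[i [l [ij kl tl]]]|[l kl tl]].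
    by exists i, l; split=> //; rewrite ltnS ltnW.
  by exists j, l.
move=> [i [l [+ kl tl]]]; rewrite ltnS leq_eqVlt => /orP[/eqP ij|ij].
  by right; exists l => //; rewrite -ij.
by left; apply/IH; exists i, l.
Qed.

(** By construction, a segment is kept only if it avoids those of smaller scales. *)
Lemma kept_disjoint i i' l l' (t : R) : kept_at i l -> kept_at i' l' ->
  seg l (2 ^ i) t -> seg l' (2 ^ i') t -> i = i'.
Proof.
wlog ii' : i i' l l' / (i <= i')%N => [W kl kl' tl tl'|].
  by have [ii'|/ltnW ii'] := leqP i i'; [exact: W ii' kl kl' tl tl'|
    exact/esym/(W _ _ _ _ ii' kl' kl tl' tl)].
move=> kl [_ _ k'0] tl tl'; move: ii'; rewrite leq_eqVlt => /orP[/eqP//|ii'].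
suff : (seg l' (2 ^ i') `&` cov i') t by rewrite k'0.
by split=> //; apply/coveredP; exists i, l.
Qed.

Lemma location_bounds j l : (j < nb_scales n)%N -> locations n (2 ^ j) l ->
  (2 ^ j + 1 <= l)%N /\ (l + 2 ^ j <= n.+1)%N.
Proof.
move=> jn.
have n0 : (0 < n)%N by case: (n) jn.
have rn : (2 * 2 ^ j <= n)%N.
  rewrite -expnS (leq_trans _ (trunc_logP (isT : (1 < 2)%N) n0))//.
  by rewrite leq_exp2l.
rewrite /locations; case: eqP => [-> /=|r1]; first by lia.
move=> [[m /= /andP[m2 mn] <-]|/= ->]; last by lia.
case: j jn rn mn r1 => [|j] jn rn mn r1; first by rewrite expn0 in r1.
rewrite expnS mulKn//; rewrite expnS in rn mn.
have := leq_divM (2 * n) (2 * 2 ^ j); move: mn.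
set q := (2 * n %/ _)%N => mn qn.
have r0 : (0 < 2 ^ j)%N by rewrite expn_gt0.
have : (m * 2 ^ j + 2 * 2 ^ j <= n)%N by rewrite -mulnDl; nia.
have : (2 * 2 ^ j <= m * 2 ^ j)%N by rewrite leq_mul2r m2 orbT.
lia.
Qed.

Lemma closed_region : closed region.
Proof.
have [L Lfin LE] := covered_bigcup c0 B delta n x (nb_scales n).
rewrite /region /detection_region LE; apply: closed_bigcup => // z _.
exact: itv_closed.
Qed.

(** The region is a finite union of compact intervals, so that a component is a
    compact interval, and it contains a whole kept segment. *)
Lemma component_itv C : components c0 B delta n x C -> exists i l,
  [/\ (i < nb_scales n)%N, kept_at i l, seg l (2 ^ i) `<=` C,
   C = `[inf C, sup C]%classic & 2 <= inf C /\ sup C <= n%:R].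
Proof.
move=> [t + <-]; rewrite -/region => rt; set C' := connected_component region t.
have Ct : C' t by exact: connected_component_refl.
have bnd z : C' z -> 2 <= z <= n%:R.
  move=> /connected_component_sub/coveredP[i [l [ij [loc _ _]]]].
  have [h1 h2] := location_bounds ij loc.
  rewrite /seg /= in_itv/= => /andP[z1 z2].
  have : (2 ^ i + 1)%:R <= l%:R :> R by rewrite ler_nat.
  have : (l + 2 ^ i)%:R <= n.+1%:R :> R by rewrite ler_nat.
  by rewrite !natrD -natr1; lra.
have lb : has_lbound C' by exists 2 => z /bnd/andP[].
have ub : has_ubound C' by exists n%:R => z /bnd/andP[].
have C0 : C' !=set0 by exists t.
have clC : closed C' by apply: component_closed; exact: closed_region.
have supC : C' (sup C') by apply: clC; exact: closure_sup.
have infC : C' (inf C').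
  apply: itv_closed_infimums => //; split; first exact: ge_inf.
  by move=> z zC; exact: lb_le_inf.
have [i [l [ij kl tl]]] := (coveredP _ _).1 rt.
exists i, l; split=> //.
- apply: connected_component_max => //; last exact: seg_connected.
  by move=> z zl; apply/coveredP; exists i, l.
- apply/seteqP; split=> z /=; rewrite in_itv/=.
    by move=> zC; rewrite ge_inf// ub_le_sup.
  have : is_interval C' by apply/connected_intervalP; exact: component_connected.
  exact.
- by have /andP[] := bnd _ infC; have /andP[] := bnd _ supC.
Qed.

Lemma tau_hatP t : t \in tau_hat c0 B delta n x <->
  exists2 C, components c0 B delta n x C & t = (inf C + sup C) / 2.
Proof.
rewrite mem_sort; split.
  move=> /mapP[C]; rewrite in_fset_set ?inE; last exact: finite_components.
  by move=> CC ->; exists C.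
move=> [C CC ->]; apply/mapP; exists C => //.
by rewrite in_fset_set ?inE//; exact: finite_components.
Qed.

Lemma components_eq C C' t : components c0 B delta n x C ->
  components c0 B delta n x C' -> C t -> C' t -> C = C'.
Proof.
move=> [u _ <-] [u' _ <-] ut u't.
by rewrite (same_connected_component ut) (same_connected_component u't).
Qed.

(** Two distinct components are disjoint, hence at most one contains t. *)
Lemma count_tau_hat_le1 (A : pred R) t :
  (forall C, components c0 B delta n x C -> A ((inf C + sup C) / 2) -> C t) ->
  (count A (tau_hat c0 B delta n x) <= 1)%N.
Proof.
move=> HA; rewrite /tau_hat count_sort count_map -size_filter.
set s := (X in size X).
have us : uniq s by rewrite filter_uniq// fset_uniq.
have memP D : (D \in s) = A ((inf D + sup D) / 2) &&
    (D \in fset_set (components c0 B delta n x)) by rewrite mem_filter.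
case: s us memP => [|C [|C' s]]//= + memP.
rewrite inE negb_or -andbA => /andP[/eqP CC' _]; exfalso; apply: CC'.
have hC D : D \in [:: C, C' & s] -> components c0 B delta n x D /\ D t.
  rewrite memP => /andP[AD]; rewrite in_fset_set ?inE; last exact: finite_components.
  by move=> cD; split=> //; exact: HA.
have [c1 Ct] := hC C (mem_head _ _).
have [|c2 C't] := hC C'; first by rewrite inE mem_head orbT.
exact: components_eq c1 c2 Ct C't.
Qed.

End Components.

(** * Spurious and detected change-points when the tests have no false positive *)

Section NoSpurious.
Context {R : realType} {p : nat}.
Variables (c0 B delta : R) (n : nat) (x : nat -> 'cV[R]_p).
Variables (K : nat) (tau : nat -> nat).
Hypothesis tau_lt : forall k, (k <= K)%N -> (tau k < tau k.+1)%N.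
Hypothesis no_false_positive : forall j l, (j < nb_scales n)%N ->
  locations n (2 ^ j) l -> test c0 B delta n x l (2 ^ j) ->
  exists2 k, (1 <= k <= K)%N & seg l (2 ^ j) ((tau k)%:R : R).

Lemma tau_homo i j : (i <= j)%N -> (j <= K.+1)%N -> (tau i <= tau j)%N.
Proof.
elim: j => [|j IH]; first by rewrite leqn0 => /eqP ->.
rewrite leq_eqVlt => /orP[/eqP ->//|]; rewrite ltnS => ij jK.
by apply: leq_trans (IH ij (ltnW jK)) (ltnW (tau_lt _)).
Qed.

Lemma component_change_point C : components c0 B delta n x C ->
  exists2 k, (1 <= k <= K)%N & C (tau k)%:R.
Proof.
move=> /component_itv[i [l [ij [loc tl _] sC _ _]]].
by have [k kK kl] := no_false_positive ij loc tl; exists k => //; exact: sC.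
Qed.

(** A component contains some change-point tau i and is symmetric about its
    midpoint. If the midpoint lies in the zone of tau k, then tau k is at least as
    close to it as tau i, hence tau k belongs to the component as well. *)
Lemma mid_zone_component C k : components c0 B delta n x C -> (1 <= k <= K)%N ->
  (inf C + sup C) / 2 \in (zone tau k : interval R) -> C (tau k)%:R.
Proof.
move=> CC kK; have [i iK Ci] := component_change_point CC.
have [_ [_ [_ _ _ CE _]]] := component_itv CC.
rewrite /zone in_itv/= => /andP[m1 m2].
move: Ci; rewrite CE /= !in_itv/= => /andP[i1 i2].
have [k1 kK'] := andP kK; have [i1' iK'] := andP iK.
have [ik|ki|<-] := ltngtP i k; last by rewrite i1.
  have : (tau i)%:R <= (tau k.-1)%:R :> R.
    by rewrite ler_nat tau_homo//; lia.
  have : (tau k.-1)%:R <= (tau k)%:R :> R by rewrite ler_nat tau_homo//; lia.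
  by move=> h1 h2; apply/andP; split; lra.
have : (tau k.+1)%:R <= (tau i)%:R :> R by rewrite ler_nat tau_homo//; lia.
have : (tau k)%:R <= (tau k.+1)%:R :> R by rewrite ler_nat tau_homo//; lia.
by move=> h1 h2; apply/andP; split; lra.
Qed.

(** Count of the midpoints in a zone: all their components contain tau k. For the
    range of the estimates: the components are contained in [2, n], and reflecting a
    change-point of the component about the midpoint stays in it. *)
Lemma no_spurious_tau_hat : no_spurious n K tau (tau_hat c0 B delta n x).
Proof.
rewrite /no_spurious; case: eqP => [K0|/eqP K0].
  case E : (tau_hat _ _ _ _ _) => [//|t s].
  have /tau_hatP[C /component_change_point[k]] :
    t \in tau_hat c0 B delta n x by rewrite E mem_head.
  by rewrite K0; case: k.
split=> [k kK|t /tau_hatP[C CC ->]].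
  by apply: (@count_tau_hat_le1 _ _ _ _ _ _ _ _ (tau k)%:R) => C CC; exact: mid_zone_component.
have [k /andP[k1 kK] Ck] := component_change_point CC.
have [_ [_ [_ _ _ CE [lo hi]]]] := component_itv CC.
rewrite CE /= in_itv/= in Ck; have [h1 h2] := andP Ck; rewrite in_itv/=.
have : (tau 1%N)%:R <= (tau k)%:R :> R by rewrite ler_nat tau_homo//; lia.
have : (tau k)%:R <= (tau K)%:R :> R by rewrite ler_nat tau_homo//; lia.
by move=> h3 h4; apply/andP; split; lra.
Qed.

(** Either the segment seg l (2 ^ j) is kept, or it meets a kept segment of a
    smaller scale. The latter contains a true change-point, which can only be tau k
    since tau k is isolated at this scale. So tau k is in the detection region. A
    kept segment that meets one through tau k has the same scale and contains tau k
    for the same reason; therefore the component of tau k is exactly the union of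
    the kept segments through tau k, and its midpoint is close to tau k. *)
Lemma detection k j l : (1 <= k <= K)%N -> (j < nb_scales n)%N ->
  locations n (2 ^ j) l -> test c0 B delta n x l (2 ^ j) ->
  seg l (2 ^ j) ((tau k)%:R : R) -> (4 * 2 ^ j <= spacing tau k)%N ->
  exists2 t, t \in tau_hat c0 B delta n x & `|t - (tau k)%:R| <= (2 ^ j)%:R :> R.
Proof.
move=> kK jn loc tl kl sep; have [k1 kK'] := andP kK.
set tk : R := (tau k)%:R.
have pow_le i i' : (i <= i')%N -> (2 ^ i)%:R <= (2 ^ i')%:R :> R.
  by move=> ii'; rewrite ler_nat leq_exp2l.
have pow_ge1 i : 1 <= (2 ^ i)%:R :> R by rewrite ler1n expn_gt0.
have isolated k' : (1 <= k' <= K)%N -> `|(tau k')%:R - tk| < 4 * (2 ^ j)%:R ->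
    k' = k.
  move=> /andP[k'1 k'K]; rewrite ltr_norml => /andP[h1 h2].
  move: sep; rewrite /spacing leq_min => /andP[s1 s2].
  have [k'k|kk'|//] := ltngtP k' k.
    have : (tau k')%:R <= (tau k.-1)%:R :> R by rewrite ler_nat tau_homo//; lia.
    have : (4 * 2 ^ j + tau k.-1)%:R <= (tau k)%:R :> R.
      rewrite ler_nat; clear -s2; have : (0 < 2 ^ j)%N by rewrite expn_gt0.
      by move: s2; set r := (2 ^ j)%N; lia.
    by rewrite natrD natrM -/tk => *; exfalso; lra.
  have : (tau k.+1)%:R <= (tau k')%:R :> R by rewrite ler_nat tau_homo//; lia.
  have : (4 * 2 ^ j + tau k)%:R <= (tau k.+1)%:R :> R.
    rewrite ler_nat; clear -s1; have : (0 < 2 ^ j)%N by rewrite expn_gt0.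
    by move: s1; set r := (2 ^ j)%N; lia.
  by rewrite natrD natrM -/tk => *; exfalso; lra.
pose kept_at i l := kept c0 B delta n x (2 ^ i) (covered c0 B delta n x i) l.
have seg_dist i l1 (t t' : R) : seg l1 (2 ^ i) t -> seg l1 (2 ^ i) t' ->
    `|t - t'| <= 2 * (2 ^ i)%:R - 2.
  rewrite /seg /= !in_itv/= => /andP[a1 a2] /andP[b1 b2].
  by rewrite ler_norml; apply/andP; split; lra.
have distT (t t' t'' : R) : `|t - t''| <= `|t - t'| + `|t' - t''|.
  by rewrite -[t - t''](subrKA t') ler_normD.
have [i [l0 [ij kl0 tkl0]]] : exists i l0,
    [/\ (i <= j)%N, kept_at i l0 & seg l0 (2 ^ i) tk].
  have [disj|/set0P[t [tl1 /coveredP[i [l0 [ij kl0 tl0]]]]]] :=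
    eqVneq (seg l (2 ^ j) `&` covered c0 B delta n x j) set0.
    by exists j, l.
  exists i, l0; split=> //; first exact: ltnW.
  have [loc0 test0 _] := kl0.
  have [k' k'K k'l] := no_false_positive (ltn_trans ij jn) loc0 test0.
  rewrite /tk -(isolated k' k'K)//.
  have := distT (tau k')%:R t tk; have := seg_dist _ _ _ _ k'l tl0.
  have := seg_dist _ _ _ _ tl1 kl; have := pow_le _ _ (ltnW ij); rewrite -/tk; lra.
have in_jn : (i < nb_scales n)%N by exact: leq_ltn_trans ij jn.
pose region := detection_region c0 B delta n x.
pose C := connected_component region tk.
have rtk : region tk by apply/coveredP; exists i, l0.
have CC : components c0 B delta n x C by exists tk.
have Ctk : C tk by exact: connected_component_refl.
(* U and V are disjoint closed sets that cover the region, hence U contains the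
   connected set C. *)
pose U := \bigcup_(l in [set l | kept_at i l /\ seg l (2 ^ i) tk]) (seg l (2 ^ i) : set R).
pose V := \bigcup_(z in [set z : nat * nat |
  [/\ (z.1 < nb_scales n)%N, kept_at z.1 z.2 & ~ seg z.2 (2 ^ z.1) tk]])
  (seg z.2 (2 ^ z.1) : set R).
have clU : closed U.
  apply: closed_bigcup => [|l1 _]; last exact: itv_closed.
  by apply: sub_finite_set (finite_locations n (2 ^ i)) => l1 /= [[]].
have clV : closed V.
  apply: closed_bigcup => [|z _]; last exact: itv_closed.
  apply: (@sub_finite_set _ _ (\bigcup_(i in `I_(nb_scales n))
    ((fun l => (i, l)) @` locations n (2 ^ i)))).
    by move=> [i1 l1] /= [h [hl _ _] _]; exists i1 => //; exists l1.
  apply: bigcup_finite; first exact: finite_II.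
  by move=> i1 _; apply: finite_image; exact: finite_locations.
have regionUV : region `<=` U `|` V.
  move=> t /coveredP[i1 [l1 [i1n kl1 tl1]]].
  have [tkl1|tkl1] := pselect (seg l1 (2 ^ i1) tk).
    have ii1 : i1 = i by exact: kept_disjoint kl1 kl0 tkl1 tkl0.
    by left; exists l1; rewrite -ii1.
  by right; exists (i1, l1).
have UV0 t : U t -> V t -> False.
  move=> [l1 /= [kl1 tkl1] tl1] [[i2 l2] /= [i2n kl2 tkl2] tl2].
  have ii2 := kept_disjoint kl1 kl2 tl1 tl2; subst i2.
  have [loc2 test2 _] := kl2.
  have [k' k'K k'l] := no_false_positive in_jn loc2 test2.
  apply: tkl2; rewrite /tk -(isolated k' k'K)//.
  have := distT (tau k')%:R t tk; have := seg_dist _ _ _ _ k'l tl2.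
  have := seg_dist _ _ _ _ tl1 tkl1; have := pow_le _ _ ij; have := pow_ge1 j; lra.
have CU : C `<=` U.
  suff -> : C = C `&` U by move=> t [].
  apply/esym; apply: (@component_connected _ region tk).
  - by exists tk; split=> //; exists l0.
  - exists (~` V); first exact: closed_openC.
    apply/seteqP; split=> t [Ct].
      by move=> Ut; split=> // Vt; exact: UV0 Ut Vt.
    by move=> nVt; split=> //; case: (regionUV _ (connected_component_sub Ct)).
  - by exists U.
exists ((inf C + sup C) / 2); first by apply/tau_hatP; exists C.
have [_ [_ [_ _ _ CE _]]] := component_itv CC.
have hC t : C t -> `|t - tk| <= 2 * (2 ^ j)%:R - 2.
  move=> /CU[l1 /= [_ tkl1] tl1].
  by have := seg_dist _ _ _ _ tl1 tkl1; have := pow_le _ _ ij; lra.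
move: Ctk; rewrite {1}CE /= in_itv/= => /andP[lo hi].
have Cin z : inf C <= z -> z <= sup C -> C z.
  by move=> z1 z2; rewrite CE /= in_itv/= z1.
have Cinf : C (inf C) by apply: Cin => //; exact: le_trans hi.
have Csup : C (sup C) by apply: Cin => //; exact: le_trans hi.
have := hC _ Cinf; have := hC _ Csup.
rewrite !ler_norml => /andP[a1 a2] /andP[b1 b2].
by apply/andP; split; lra.
Qed.

End NoSpurious.

(** * The tests when the empirical covariances are accurate *)

Section TestsUnderEvent.
Context {R : realType} {p : nat}.
Variables (c0 B delta : R) (n : nat) (x : nat -> 'cV[R]_p).
Variables (Sigma : nat -> 'M[R]_p) (K : nat) (tau : nat -> nat).
Hypothesis change_pts : change_points n Sigma K tau.

Let thr r := @threshold R p c0 B delta n r.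

Hypothesis thr_gt0 : forall j, (j < nb_scales n)%N -> 0 < thr (2 ^ j).
Hypothesis error_le : forall j a, (j < nb_scales n)%N ->
  (a + 2 ^ j <= n.+1)%N -> a \in window_starts n (2 ^ j) ->
  opnorm (window_error x Sigma a (2 ^ j)) <= thr (2 ^ j) / 4.

Let tau_lt k : (k <= K)%N -> (tau k < tau k.+1)%N.
Proof. by case: change_pts => _ _ + _ _; exact. Qed.

(* Difference of the mean covariances on both sides of l: the deterministic part
   of the test statistic. *)
Let drift l r : 'M[R]_p :=
  r%:R^-1 *: (\sum_(l <= t < l + r) Sigma t - \sum_(l - r <= t < l) Sigma t).

Lemma location_starts j l : (j < nb_scales n)%N -> locations n (2 ^ j) l ->
  (l \in window_starts n (2 ^ j)) && ((l - 2 ^ j)%N \in window_starts n (2 ^ j)).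
Proof.
move=> jn.
have n0 : (0 < n)%N by case: (n) jn.
have rn : (2 * 2 ^ j <= n)%N.
  rewrite -expnS (leq_trans _ (trunc_logP (isT : (1 < 2)%N) n0))//.
  by rewrite leq_exp2l.
have start_mem m : (m < 2 * n %/ 2 ^ j)%N ->
    (m * maxn 1 (2 ^ j %/ 2) + 1)%N \in window_starts n (2 ^ j).
  move=> mn; rewrite !inE; apply/or3P; apply: Or33; apply/mapP; exists m => //.
  by rewrite mem_iota.
rewrite /locations; case: eqP => [r1 /= /andP[l2 ln]|r1].
  rewrite r1 divn1 in start_mem *; apply/andP; split.
    by have := start_mem l.-1; rewrite muln1 addn1 prednK; [apply; lia|lia].
  have := start_mem l.-2; rewrite muln1 addn1.
  by rewrite (_ : l.-2.+1 = (l - 1)%N); [apply; lia|lia].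
case: j jn rn start_mem r1 => [//|j] jn rn start_mem r1.
have maxE : maxn 1 (2 ^ j.+1 %/ 2) = (2 ^ j.+1 %/ 2)%N.
  by rewrite expnS mulKn//; apply/maxn_idPr; rewrite expn_gt0.
move=> [[m /= /andP[m2 mn] <-]|/= ->].
  rewrite -maxE start_mem/=; last by clear -m2 mn; lia.
  have -> : (m * maxn 1 (2 ^ j.+1 %/ 2) + 1 - 2 ^ j.+1)%N =
      ((m - 2) * maxn 1 (2 ^ j.+1 %/ 2) + 1)%N.
    rewrite maxE expnS mulKn// mulnBl.
    have : (2 * 2 ^ j <= m * 2 ^ j)%N by rewrite leq_mul2r m2 orbT.
    by clear; set u := (m * _)%N; set v := (2 * _)%N; lia.
  by apply: start_mem; clear -m2 mn; lia.
rewrite !inE eqxx/=; apply/orP; right; apply/orP; left; apply/eqP.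
by clear -rn; move: rn; set v := (2 ^ _)%N; lia.
Qed.

Let cov_diffE j l : (j < nb_scales n)%N -> locations n (2 ^ j) l ->
  cov_right x l (2 ^ j) - cov_left x l (2 ^ j) =
  window_error x Sigma l (2 ^ j) - window_error x Sigma (l - 2 ^ j) (2 ^ j)
  + drift l (2 ^ j).
Proof.
move=> jn loc; have [h _] := location_bounds jn loc.
rewrite /window_error subnK; last by apply: leq_trans h; rewrite leq_addr.
rewrite /cov_right /cov_left /drift !sumrB -!scalerBr -scalerDr; congr (_ *: _).
by rewrite opprB addrAC !subrKA.
Qed.

(** Without change-point in the segment, the two means coincide, and the statistic
    is at most twice a quarter of the threshold. *)
Lemma no_false_positive j l : (j < nb_scales n)%N -> locations n (2 ^ j) l ->
  test c0 B delta n x l (2 ^ j) ->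
  exists2 k, (1 <= k <= K)%N & seg l (2 ^ j) ((tau k)%:R : R).
Proof.
move=> jn loc tl; have [h1 h2] := location_bounds jn loc.
have [tau0 tauK _ Scst _] := change_pts.
have r0 : (0 < 2 ^ j)%N by rewrite expn_gt0.
set r := (2 ^ j)%N in h1 h2 r0 loc tl *.
(* index of the stretch that contains the leftmost time l - r of the windows *)
pose k := [arg max_(i > ord0 : 'I_K.+1 | (tau i <= l - r)%N) i]%N.
have [k0 kP kmax] : [/\ (k <= K)%N, (tau k <= l - r)%N & (l - r < tau k.+1)%N].
  rewrite /k; case: arg_maxnP => [|i Pi imax]; first by rewrite tau0; lia.
  have iK : (i <= K)%N by rewrite -ltnS.
  split=> //; rewrite ltnNge; apply/negP => lt.
  have [iK'|Ki] := ltnP i K; last first.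
    have iE : i = K :> nat by apply/eqP; rewrite eqn_leq iK.
    by move: lt; rewrite iE tauK; lia.
  by have := imax (Ordinal (iK' : (i.+1 < K.+1)%N)) lt; rewrite /geq /= ltnn.
have [lt|le] := ltnP (tau k.+1) (l + r).
  have kK : (k < K)%N.
    rewrite ltn_neqAle k0 andbT; apply/eqP => kE.
    by move: lt; rewrite kE tauK; lia.
  exists k.+1; first by rewrite kK.
  rewrite /seg /= in_itv/=.
  have : (l + 1)%:R <= (tau k.+1 + r)%:R :> R by rewrite ler_nat; lia.
  have : (tau k.+1 + 1)%:R <= (l + r)%:R :> R by rewrite ler_nat; lia.
  by rewrite !natrD => *; apply/andP; split; lra.
exfalso; move: tl; rewrite /test cov_diffE// leNgt => /negP; apply.
have -> : drift l r = 0.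
  have S1 t : t \in index_iota l (l + r) -> Sigma t = Sigma (tau k).
    by rewrite mem_index_iota => tl; apply: Scst => //; lia.
  have S2 t : t \in index_iota (l - r) l -> Sigma t = Sigma (tau k).
    by rewrite mem_index_iota => tl; apply: Scst => //; lia.
  rewrite /drift (eq_big_seq _ S1) (eq_big_seq _ S2) !sumr_const_nat addKn subKn; last by lia.
  by rewrite subrr scaler0.
rewrite addr0; have /andP[m1 m2] := location_starts jn loc.
have e1 := error_le jn h2 m1.
have e2 : opnorm (window_error x Sigma (l - r) r) <= thr r / 4.
  by apply: error_le => //; rewrite -/r; lia.
have := thr_gt0 jn; have := ler_opnormD (window_error x Sigma l r)
  (- window_error x Sigma (l - r) r).
by rewrite opnormN -/r /thr in e1 e2 *; lra.
Qed.

(** The location l is the last one of the grid that does not exceed tau k, from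
    which it differs by less than r / 2. The left window is then free of
    change-points, more than half of the right one lies after tau k, and the drift is
    at least half the jump. *)
Lemma large_jump_detected j k : (1 <= k <= K)%N -> (0 < j)%N ->
  (4 * 2 ^ j <= spacing tau k)%N -> 3 * thr (2 ^ j) <= jump Sigma tau k ->
  exists l, [/\ (j < nb_scales n)%N, locations n (2 ^ j) l,
    test c0 B delta n x l (2 ^ j) & seg l (2 ^ j) ((tau k)%:R : R)].
Proof.
case: j => // i /andP[k1 kK] _; set r := (2 ^ i.+1)%N; set h := (2 ^ i)%N.
have rh : r = (2 * h)%N by rewrite /r expnS.
have h0 : (0 < h)%N by rewrite expn_gt0.
rewrite /spacing leq_min => /andP[s1 s2] J3.
have [tau0 tauK _ Scst _] := change_pts.
have tk1 : (1 <= tau k.-1)%N by rewrite -tau0; apply: (tau_homo tau_lt) => //; lia.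
have tkn : (tau k.+1 <= n.+1)%N by rewrite -tauK; apply: (tau_homo tau_lt) => //; lia.
have tk_lt : (tau k < tau k.+1)%N by exact: tau_lt.
have tk_lt' : (tau k.-1 < tau k)%N.
  by have := @tau_lt k.-1; rewrite prednK//; apply; lia.
pose m := ((tau k - 1) %/ h)%N; pose l := (m * h + 1)%N.
have mle : (m * h <= tau k - 1)%N by exact: leq_divM.
have mlt : (tau k - 1 < m * h + h)%N by have := ltn_ceil (tau k - 1) h0; rewrite mulSn addnC.
have jn : (i.+1 < nb_scales n)%N.
  rewrite /nb_scales trunc_log_max// expnS -/r; lia.
have loc : locations n r l.
  rewrite /locations ifN; last by rewrite rh; lia.
  left; exists m; last by rewrite rh mulKn.
  apply/andP; split.
    by rewrite /m leq_divRL//; lia.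
  have : (m + 2 <= 2 * n %/ r)%N.
    by rewrite leq_divRL ?rh ?muln_gt0//; nia.
  by lia.
have tl : seg l r ((tau k)%:R : R).
  rewrite /seg /= in_itv/= /l.
  have : (l + 1)%:R <= (tau k + r)%:R :> R by rewrite ler_nat /l; lia.
  have : (tau k + 1)%:R <= (l + r)%:R :> R by rewrite ler_nat /l; lia.
  by rewrite !natrD -/l => *; apply/andP; split; rewrite /l ?natrD; lra.
exists l; split=> //.
have [lb1 lb2] := location_bounds jn loc; rewrite -/r in lb1 lb2.
have /andP[m1 m2] := location_starts jn loc; rewrite -/r in m1 m2.
have e1 := error_le jn lb2 m1.
have e2 : opnorm (window_error x Sigma (l - r) r) <= thr r / 4.
  by apply: error_le => //; rewrite -/r; lia.
have ltk : (l <= tau k)%N by rewrite /l; lia.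
have tkl : (tau k <= l + r)%N by rewrite /l; lia.
have S1 t : t \in index_iota (tau k) (l + r) -> Sigma t = Sigma (tau k).
  by rewrite mem_index_iota => tt; apply: Scst => //; rewrite /l in tt; lia.
have Scst' t : (tau k.-1 <= t < tau k)%N -> Sigma t = Sigma (tau k.-1).
  by move=> tt; apply: Scst; [lia|rewrite prednK].
have S2 t : t \in index_iota l (tau k) -> Sigma t = Sigma (tau k.-1).
  by rewrite mem_index_iota => tt; apply: Scst'; rewrite /l in tt; lia.
have S3 t : t \in index_iota (l - r) l -> Sigma t = Sigma (tau k.-1).
  by rewrite mem_index_iota => tt; apply: Scst'; rewrite /l in tt; lia.
have r0 : 0 < r%:R :> R by rewrite ltr0n expn_gt0.
have driftE : drift l r = (r%:R^-1 * (l + r - tau k)%:R) *: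
    (Sigma (tau k) - Sigma (tau k.-1)).
  rewrite /drift (big_cat_nat ltk tkl)/= (eq_big_seq _ S1) (eq_big_seq _ S2).
  rewrite (eq_big_seq _ S3) !sumr_const_nat subKn; last by lia.
  rewrite -scalerA; congr (_ *: _); rewrite scalerBr !scaler_nat.
  have -> : Sigma (tau k.-1) *+ r =
      Sigma (tau k.-1) *+ (tau k - l) + Sigma (tau k.-1) *+ (l + r - tau k).
    by rewrite -mulrnDr; congr (_ *+ _); lia.
  by rewrite opprD addrACA subrr add0r.
have half : 2^-1 <= r%:R^-1 * (l + r - tau k)%:R :> R.
  rewrite ler_pdivlMl// ler_pdivrMr// -natrM ler_nat; rewrite /l; lia.
have dJ : jump Sigma tau k <= 2 * opnorm (drift l r).
  rewrite driftE opnormZ ger0_norm; last by apply: le_trans half; rewrite invr_ge0.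
  rewrite -/(jump Sigma tau k); have := opnorm_ge0 (Sigma (tau k) - Sigma (tau k.-1)).
  by rewrite -/(jump Sigma tau k) => J0; nra.
rewrite /test cov_diffE// -/r -/(thr r).
set W := window_error x Sigma l r - window_error x Sigma (l - r) r.
have hW : opnorm W <= thr r / 2.
  by apply: le_trans (ler_opnormD _ _) _; rewrite opnormN -/r in e1 e2 *; lra.
have := ler_opnormD (W + drift l r) (- W).
by rewrite opnormN addrAC subrr add0r; lra.
Qed.

End TestsUnderEvent.

(** * Conclusion *)

Section EnergyAndThreshold.
Context {R : realType} {p : nat}.
Implicit Types (c B delta g : R) (n r : nat).

Lemma threshold_gt0 (c0 : R) B delta n r : (0 < p)%N -> (0 < r)%N -> 0 < c0 -> 0 < B ->
  0 <= log_term delta n r -> 0 < @threshold R p c0 B delta n r.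
Proof.
move=> p0 r0 c00 B0 L0; rewrite /threshold -/(log_term delta n r).
have rR : 0 < r%:R :> R by rewrite ltr0n.
have P0 : 0 < p%:R / r%:R :> R by rewrite divr_gt0 ?ltr0n.
have Q0 : 0 <= log_term delta n r / r%:R by rewrite divr_ge0 // ltW.
rewrite mulr_gt0 ?mulr_gt0 ?exprn_gt0//.
have := sqrtr_ge0 (p%:R / r%:R : R); have := sqrtr_ge0 (log_term delta n r / r%:R).
lra.
Qed.

(** With q = g / (12 c0) <= 1, the energy condition says that p / r and the
    logarithmic term over r are at most q^2 <= q; each of the four terms of the
    threshold is at most q. *)
Lemma threshold_le (c0 : R) B delta g n r : 1 <= c0 -> 0 < B -> 0 < g <= 4 ->
  (0 < r)%N -> 0 <= log_term delta n r ->
  (12 * c0) ^+ 2 * (p%:R + log_term delta n r) <= r%:R * g ^+ 2 ->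
  3 * @threshold R p c0 B delta n r <= B ^+ 2 * g.
Proof.
move=> c01 B0 /andP[g0 g4] r0 L0 energy.
have rR : 0 < r%:R :> R by rewrite ltr0n.
have k0 : 0 < 12 * c0 by lra.
pose q := g / (12 * c0).
have q0 : 0 < q by rewrite divr_gt0.
have q1 : q <= 1 by rewrite ler_pdivrMr//; lra.
have small z : 0 <= z -> z <= p%:R + log_term delta n r ->
    Num.sqrt (z / r%:R) + z / r%:R <= 2 * q.
  move=> z0 zle; have zq : z / r%:R <= q ^+ 2.
    rewrite ler_pdivrMr// /q exprMn exprVn mulrAC ler_pdivlMr ?exprn_gt0//.
    rewrite mulrC [leRHS]mulrC; apply: le_trans energy.
    by rewrite ler_wpM2l ?sqr_ge0.
  have : Num.sqrt (z / r%:R) <= q.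
    by rewrite -(ger0_norm (ltW q0)) -sqrtr_sqr ler_sqrt ?sqr_ge0.
  have : q ^+ 2 <= q by rewrite expr2 ler_piMl// ltW.
  lra.
rewrite /threshold -/(log_term delta n r).
have h1 := small p%:R (ler0n _ _) ltac:(by rewrite lerDl).
have h2 := small _ L0 ltac:(by rewrite lerDr ler0n).
apply: (@le_trans _ _ (3 * (c0 * B ^+ 2 * (4 * q)))).
  rewrite ler_wpM2l// ler_wpM2l//; last lra.
  by rewrite mulr_ge0 ?sqr_ge0//; lra.
by rewrite le_eqVlt; apply/orP; left; apply/eqP; rewrite /q; field; lra.
Qed.

Lemma dH1_le (est : seq R) t a : t \in est -> (dH1 est a <= `|t - a|%:E)%E.
Proof.
rewrite /dH1; elim: est => [//|z s IH]; rewrite inE big_cons ge_min.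
by case/predU1P => [->|/IH ->]; rewrite ?lexx ?orbT.
Qed.

Lemma mem_zone tau k (t b : R) : (4 * b <= (spacing tau k)%:R :> R) ->
  `|t - (tau k)%:R| <= b -> (tau k.-1 <= tau k <= tau k.+1)%N ->
  t \in (zone tau k : interval R).
Proof.
move=> sb tb /andP[k1 k2]; rewrite /zone in_itv/=.
have : (spacing tau k)%:R <= (tau k.+1)%:R - (tau k)%:R :> R.
  by rewrite -natrB// ler_nat geq_minl.
have : (spacing tau k)%:R <= (tau k)%:R - (tau k.-1)%:R :> R.
  by rewrite -natrB// ler_nat geq_minr.
have b0 : 0 <= b by exact: le_trans tb.
by move: tb; rewrite ler_norml => /andP[t1 t2] h1 h2; apply/andP; split; lra.
Qed.

End EnergyAndThreshold.

(** The quadratic forms of both matrices take values in [0, 4 B^2] on the unit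
    sphere, hence so does the absolute value of their difference. *)
Lemma opnorm_cov_matrixB_le (d : measure_display) (T : measurableType d)
    (R : realType) (p : nat) (P : probability T R) (y z : {RV P >-> borelV R p})
    (B : R) : 0 < B ->
  centered P y -> centered P z ->
  (psi2v P y <= B%:E)%E -> (psi2v P z <= B%:E)%E ->
  opnorm (cov_matrix P y - cov_matrix P z) <= 4 * B ^+ 2.
Proof.
move=> B0 cy cz yB zB; apply: opnorm_le_quad.
- by rewrite linearB/= !cov_matrix_sym.
- by rewrite mulr_ge0 ?sqr_ge0.
move=> v v1; have v1' : norm2 v <= 1 by rewrite v1.
have /andP[y1 y2] := quad_cov_matrix_bounds B0 cy yB v1'.
have /andP[z1 z2] := quad_cov_matrix_bounds B0 cz zB v1'.
by rewrite quadB ler_norml; apply/andP; split; lra.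
Qed.

Section SmallErrors.
Context {R : realType} {p : nat}.
Variables (c0 B delta : R) (n : nat) (x : nat -> 'cV[R]_p).
Variables (Sigma : nat -> 'M[R]_p) (K : nat) (tau : nat -> nat).
Hypotheses (c01 : 1 <= c0) (B0 : 0 < B) (delta01 : 0 < delta < 1).
Hypotheses (n2 : (2 <= n)%N) (p1 : (1 <= p)%N).
Hypothesis cps : change_points n Sigma K tau.
Hypothesis jump_le : forall k, (1 <= k <= K)%N ->
  jump Sigma tau k <= 4 * B ^+ 2.
Hypothesis errors : forall j a, (j < nb_scales n)%N ->
  (a + 2 ^ j <= n.+1)%N -> a \in window_starts n (2 ^ j) ->
  opnorm (window_error x Sigma a (2 ^ j)) <= @threshold R p c0 B delta n (2 ^ j) / 4.

Let kappa := (12 * c0) ^+ 2.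

(** No probability is left here: x is one realization of the observations, and Sigma
    is any piecewise constant sequence of matrices with jumps at most 4 B^2. *)
Lemma performance_small_errors (est := tau_hat c0 B delta n x) :
  [/\ no_spurious n K tau est,
      (forall k, (1 <= k <= K)%N ->
         high_energy ((32 * kappa) ^+ 2) B delta n Sigma tau k ->
         detected tau k est) &
      (forall k, (1 <= k <= K)%N ->
         high_energy ((32 * kappa) ^+ 2) B delta n Sigma tau k ->
         (dH1 est (tau k)%:R
            <= (localization_rate (2 * kappa) B delta n Sigma tau k)%:E)%E /\
         localization_rate (2 * kappa) B delta n Sigma tau k
           <= (spacing tau k)%:R / 4)].
Proof.
have c0_ge1 := c01; have kappa16 : 16 < kappa.
  have : 0 <= (c0 - 1) * (c0 + 1) by rewrite mulr_ge0//; lra.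
  by rewrite /kappa expr2; lra.
have [tau0 tauK tau_lt _ _] := cps.
have [delta0 delta1] := andP delta01.
have log_ge0 r : (0 < r)%N -> (r <= 2 * n)%N -> 0 <= log_term delta n r.
  move=> r0 rn; apply: ln_ge0; rewrite ler_pdivlMr ?mulr_gt0 ?ltr0n// mul1r.
  rewrite -natrM; apply: le_trans (_ : r%:R <= _); last by rewrite ler_nat.
  by rewrite ler_piMl// ltW.
have thr_gt0 j : (j < nb_scales n)%N -> 0 < @threshold R p c0 B delta n (2 ^ j).
  move=> jn; apply: threshold_gt0; rewrite ?expn_gt0//; first lra.
  apply: log_ge0; rewrite ?expn_gt0//.
  apply: (@leq_trans n); last exact: leq_pmull.
  apply: leq_trans (trunc_logP (isT : (1 < 2)%N) (leq_trans (isT : (0 < 2)%N) n2)).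
  by rewrite leq_exp2l// ltnW.
have nofp := no_false_positive cps thr_gt0 errors.
have in_range k : (k <= K)%N -> (1 <= tau k <= n)%N.
  move=> kK; have := tau_homo tau_lt (leq0n k) (leqW kK).
  rewrite tau0 => ->/=; rewrite -ltnS -tauK.
  by apply: leq_trans (tau_lt _ kK) _; exact: (tau_homo tau_lt).
have key k : (1 <= k <= K)%N ->
    high_energy ((32 * kappa) ^+ 2) B delta n Sigma tau k ->
    let rate := localization_rate (2 * kappa) B delta n Sigma tau k in
    rate <= (spacing tau k)%:R / 4 /\
    exists2 t, t \in est & `|t - (tau k)%:R| <= rate.
  move=> kK; have [k1 kK'] := andP kK.
  have kK1 : (k.-1 <= K)%N by exact: leq_trans (leq_pred _) kK'.
  have /andP[a1 a2] := in_range _ kK1; have /andP[b1 b2] := in_range _ kK'.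
  have lt1 : (tau k.-1 < tau k)%N by have := tau_lt _ kK1; rewrite prednK.
  have lt2 := tau_lt _ kK'.
  have top : (tau k.+1 <= n.+1)%N by rewrite -tauK (tau_homo tau_lt).
  have s0 : (0 < spacing tau k)%N by rewrite /spacing leq_min !subn_gt0 lt2 lt1.
  have sn : (2 * spacing tau k <= n)%N.
    have := geq_minl (tau k.+1 - tau k) (tau k - tau k.-1).
    have := geq_minr (tau k.+1 - tau k) (tau k - tau k.-1).
    rewrite -/(spacing tau k); clear -a1 lt1 lt2 top; lia.
  set s := spacing tau k in s0 sn *.
  have sR : 0 < s%:R :> R by rewrite ltr0n.
  have B4 : 0 < B ^+ 4 by rewrite exprn_gt0.
  have B2 : 0 < B ^+ 2 by rewrite exprn_gt0.
  set g := jump Sigma tau k / B ^+ 2.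
  have jumpE : jump Sigma tau k = B ^+ 2 * g by rewrite mulrC divfK// gt_eqF.
  have jump0 : 0 <= jump Sigma tau k by exact: opnorm_ge0.
  have g0 : 0 <= g by rewrite divr_ge0// ltW.
  have g4 : g <= 4.
    rewrite ler_pdivrMr//; exact: jump_le.
  have sqrE : jump Sigma tau k ^+ 2 = B ^+ 4 * g ^+ 2 by rewrite jumpE; ring.
  rewrite /high_energy /= -/s sqrE => energy.
  have {}energy : (32 * kappa) ^+ 2 * (p%:R + log_term delta n s) <= s%:R * g ^+ 2.
    have : (32 * kappa) ^+ 2 *
        Num.min (p%:R + ln (2 * n%:R / (s%:R * delta))) s%:R <= s%:R * g ^+ 2.
      by rewrite -(ler_pM2l B4); move: energy; lra.
    (* the minimum is not s, since the squared jump is at most 16 B^4 *)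
    rewrite minEle; case: ifP => _; first by rewrite /log_term [delta * _]mulrC.
    rewrite mulrC ler_pM2l// => h; exfalso.
    have : g ^+ 2 <= 16 by rewrite expr2; nra.
    by move: h; rewrite (expr2 (32 * _)); nra.
  have Ls : 0 <= log_term delta n s.
    by apply: log_ge0 => //; apply: leq_trans (leq_trans sn _); rewrite leq_pmull.
  have g_gt0 : 0 < g.
    rewrite lt_def g0 andbT; apply/eqP => g0'; move: energy.
    have S2 : 0 < (32 * kappa) ^+ 2 by apply: exprn_gt0; lra.
    have pL : 0 < p%:R + log_term delta n s by rewrite ltr_pwDl ?ltr0n.
    by rewrite g0' expr0n mulr0 leNgt mulr_gt0.
  have a16 : 0 < g ^+ 2 <= 16 by rewrite exprn_gt0//= expr2; nra.
  have [rate_le [j [j0 jE jrate]]] :=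
    scale_selection delta01 a16 kappa16 p1 s0 sn energy.
  have rateE : localization_rate (2 * kappa) B delta n Sigma tau k =
      2 * kappa * ((p%:R + ln (2 * delta^-1 * n%:R * g ^+ 2)) / g ^+ 2).
    rewrite /localization_rate sqrE.
    have -> : 2 * delta^-1 * B ^- 4 * n%:R * (B ^+ 4 * g ^+ 2) =
        2 * delta^-1 * n%:R * g ^+ 2 by field; rewrite !gt_eqF.
    by field; rewrite !gt_eqF.
  rewrite rateE; split=> //.
  have sep : (4 * 2 ^ j <= spacing tau k)%N.
    rewrite -/s -(ler_nat R) natrM; have := le_trans jrate rate_le; lra.
  have rn : (2 ^ j <= 2 * n)%N.
    by move: sep sn; rewrite -/s; clear; set r := (2 ^ j)%N; lia.
  have J3 : 3 * @threshold R p c0 B delta n (2 ^ j) <= jump Sigma tau k.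
    rewrite jumpE; apply: threshold_le => //; rewrite ?expn_gt0 ?g_gt0//.
    by apply: log_ge0; rewrite ?expn_gt0.
  have [l [jn loc tl kl]] := large_jump_detected cps errors kK j0 sep J3.
  have [t test_ tk] := detection tau_lt nofp kK jn loc tl kl sep.
  by exists t => //; exact: le_trans jrate.
split.
- exact: no_spurious_tau_hat tau_lt nofp.
- move=> k kK /(key _ kK)[rate_le [t test_ tk]]; exists t => //.
  have [k1 kK'] := andP kK.
  apply: mem_zone tk _; first by move: rate_le; lra.
  rewrite (ltnW (tau_lt _ kK')) andbT.
  by apply: (tau_homo tau_lt); [exact: leq_pred|exact: leqW].
- move=> k kK /(key _ kK)[rate_le [t test_ tk]]; split=> //.
  by apply: le_trans (dH1_le _ test_) _; rewrite lee_fin.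
Qed.

End SmallErrors.

Theorem proposition5 (R : realType) :
  exists c0 c1 c2 : R, [/\ 0 < c0, 0 < c1, 0 < c2 &
  forall (n p : nat) (delta B : R),
    (2 <= n)%N -> (1 <= p)%N -> 0 < delta < 1 -> 0 < B ->
  forall (d : measure_display) (T : measurableType d) (P : probability T R)
    (y : nat -> {RV P >-> borelV R p}),
    mutually_independent P n (fun t => y t) ->
    (forall t, (1 <= t <= n)%N -> centered P (y t)) ->
    (forall t, (1 <= t <= n)%N -> (psi2v P (y t) <= B%:E)%E) ->
  forall (K : nat) (tau : nat -> nat),
    let Sigma := fun t => cov_matrix P (y t) in
    change_points n Sigma K tau ->
  exists E : set T,
    [/\ measurable E, ((1 - delta)%:E < P E)%E &
    forall w, E w ->
      let est := tau_hat c0 B delta n (fun t => y t w : 'cV[R]_p) in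
      [/\ no_spurious n K tau est,
          (forall k, (1 <= k <= K)%N ->
             high_energy c1 B delta n Sigma tau k -> detected tau k est) &
          (forall k, (1 <= k <= K)%N ->
             high_energy c1 B delta n Sigma tau k ->
             (dH1 est (tau k)%:R
                <= (localization_rate c2 B delta n Sigma tau k)%:E)%E /\
             localization_rate c2 B delta n Sigma tau k
               <= (spacing tau k)%:R / 4)]]].
Proof.
have pos (c : R) : 0 < c ->
    0 < (32 * (12 * c) ^+ 2) ^+ 2 /\ 0 < 2 * (12 * c) ^+ 2.
  by move=> c_gt0; rewrite !(exprn_gt0, mulr_gt0).
have [c0 c0_ge1 c0E] : exists2 c0 : R, 1 <= c0 & c0 = 11520.
  by exists 11520; rewrite ?ler1n.
have c0_gt0 : 0 < c0 by exact: lt_le_trans c0_ge1.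
have [c1_gt0 c2_gt0] := pos _ c0_gt0.
exists c0, ((32 * (12 * c0) ^+ 2) ^+ 2), (2 * (12 * c0) ^+ 2); split=> //.
move=> n p delta B n2 p1 delta01 B0 d T P y indep cent psi K tau Sigma cps.
have [E [mE PE EP]] := deviation_event p1 B0 delta01 indep cent psi n2.
rewrite -c0E in EP; exists E; split=> // w Ew; apply: performance_small_errors => //.
- move=> k /andP[k1 kK]; have [tau0 tauK tau_lt _ _] := cps.
  have in_range i : (i <= K)%N -> (1 <= tau i <= n)%N.
    move=> iK; have := tau_homo tau_lt (leq0n i) (leqW iK).
    rewrite tau0 => ->/=; rewrite -ltnS -tauK.
    by apply: leq_trans (tau_lt _ iK) _; exact: (tau_homo tau_lt).
  have rk := in_range _ kK; have rk1 := in_range _ (leq_trans (leq_pred k) kK).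
  by apply: opnorm_cov_matrixB_le => //; [exact: cent|exact: cent|exact: psi|exact: psi].
- exact: EP.
Qed.
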